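(* Let $\alpha\in(0,1)$, $\alpha+\gamma>0$, let $\mathcal{Z}_{\alpha,\gamma}(x):=x^{\alpha+\gamma}Z_{\alpha,\gamma}$, $x\ge0$, and define $\mathcal{A}_{\alpha,\gamma}(t):=\inf\{x\ge 0:\mathcal{Z}_{\alpha,\gamma}(x)>t\}$ for $t\ge0$, so that $\mathbb{P}(\mathcal{A}_{\alpha,\gamma}(t)<x)=\mathbb{P}(\mathcal{Z}_{\alpha,\gamma}(x)>t)$ for all $x,t\ge0$. Then $\mathcal{A}_{\alpha,\gamma}(0)=0$ a.s. and $t\mapsto\mathcal{A}_{\alpha,\gamma}(t)$ is a.s. non-decreasing. Moreover, writing $h_{\alpha,\gamma}(x,t)$ for the density of $\mathcal{A}_{\alpha,\gamma}(t)$ in $x$, its Laplace transform in $t$, $\tilde h_{\alpha,\gamma}(x,\eta)=\int_0^\infty e^{-\eta t}h_{\alpha,\gamma}(x,t)\,dt$, is given for $x\ge0$, $\eta>0$ by $$\tilde h_{\alpha,\gamma}(x,\eta)=-\frac1\eta\frac{d}{dx}\operatorname{E}_{\alpha,1+\gamma/\alpha,\gamma/\alpha}(-\eta x^{\alpha+\gamma})=(\alpha+\gamma)x^{\alpha+\gamma-1}\sum_{l=0}^\infty (l+1)(-\eta)^l x^{l(\alpha+\gamma)}c_{l+1},$$ where the series converges for all $x,\eta$, and $$c_n=\prod_{j=0}^{n-1}\frac{\Gamma(j(\alpha+\gamma)+\gamma+1)}{\Gamma((j+1)(\alpha+\gamma)+1)}=\frac{1}{[\mathsf{n}!]^{\alpha+\gamma}_\alpha},\qquad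 n\ge1.$$
   Context: $\mathcal{A}_\alpha=\{\mathcal{A}_\alpha(s)\}_{s\ge0}$ denotes the $\alpha$-stable subordinator, i.e. the nondecreasing Lévy process with $\mathbb{E}e^{-\kappa\mathcal{A}_\alpha(s)}=e^{-s\kappa^\alpha}$. The random variable $Z_{\alpha,\gamma}$ is $Z_{\alpha,\gamma}:=\int_0^\infty(1-\mathcal{A}_\alpha(s))_+^{\gamma}\,ds$; it satisfies $\mathbb{E}e^{-\lambda t^{\alpha+\gamma}Z_{\alpha,\gamma}}=\operatorname{E}_{\alpha,1+\gamma/\alpha,\gamma/\alpha}(-\lambda t^{\alpha+\gamma})$ for $\lambda>0,t\ge0$. The Kilbas–Saigo function is $\operatorname{E}_{a,m,l}(z)=1+\sum_{n\ge1}\prod_{k=1}^n\frac{\Gamma(1+a((k-1)m+l))}{\Gamma(1+a((k-1)m+l+1))}z^n$. Notation: $[\mathsf{n}]^\beta_\alpha:=\frac{\Gamma(\beta n+1)}{\Gamma(\beta n-\alpha+1)}$ and $[\mathsf{n}!]^\beta_\alpha:=\prod_{k=1}^n[\mathsf{k}]^\beta_\alpha$, $[\mathsf{0}!]^\beta_\alpha:=1$.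
   Formalization: The Laplace transform formula is for x>0, not x≥0 (at x=0 it fails if α+γ≤1); the density is a suitable version h(x,t) for each t>0; the identity P(A(t)<x)=P(Z(x)>t), immediate from the definition, is not restated. *)

(* Defs.v *)
From HB Require Import structures.
From mathcomp Require Import all_boot all_order all_algebra.
From mathcomp Require Import all_classical all_reals all_analysis.
Set Implicit Arguments.
Unset Strict Implicit.
Unset Printing Implicit Defensive.
Import Order.TTheory GRing.Theory Num.Theory.
Import numFieldNormedType.Exports.
Local Open Scope classical_set_scope.
Local Open Scope ring_scope.

Section Defs.
Variable R : realType.

Definition Gamma (s : R) : R :=
  Rintegral lebesgue_measure `]0%R, +oo[%classic
    (fun x : R => powR x (s - 1) * expR (- x)).

Definition KS_coef (a m l : R) (n : nat) : R :=
  \prod_(1 <= k < n.+1)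
     (Gamma (1 + a * ((k.-1)%:R * m + l)) / Gamma (1 + a * ((k.-1)%:R * m + l + 1))).

Definition KilbasSaigo (a m l z : R) : R :=
  limn (series (fun n => KS_coef a m l n * z ^+ n)).

Definition gbr (beta alpha : R) (n : nat) : R :=
  Gamma (beta * n%:R + 1) / Gamma (beta * n%:R - alpha + 1).
Definition gbr_fact (beta alpha : R) (n : nat) : R :=
  \prod_(1 <= k < n.+1) gbr beta alpha k.

Definition c_coef (alpha gamma : R) (n : nat) : R :=
  \prod_(0 <= j < n)
    (Gamma (j%:R * (alpha + gamma) + gamma + 1)
       / Gamma (j.+1%:R * (alpha + gamma) + 1)).

Variables (d : measure_display) (T : measurableType d) (P : probability T R).

Definition mutually_independent (n : nat) (Y : 'I_n -> T -> R) : Prop :=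
  (forall i, measurable_fun setT (Y i)) /\
  forall B : 'I_n -> set R, (forall i, measurable (B i)) ->
    P (\bigcap_(i in [set: 'I_n]) (Y i @^-1` B i)) =
    (\prod_(i < n) P (Y i @^-1` B i))%E.

Definition stable_subordinator (alpha : R) (X : R -> T -> R) : Prop :=
  [/\ (forall s, measurable_fun setT (X s)) /\ (forall w, X 0 w = 0),
      (forall w s t, 0 <= s -> s <= t -> X s w <= X t w),
      (forall w s, 0 <= s -> (fun u => X u w) @ at_right s --> X s w),
      (forall (n : nat) (t : nat -> R), 0 <= t 0%N ->
          (forall i, (i < n)%N -> t i <= t i.+1) ->
          mutually_independent (fun (i : 'I_n) w => X (t i.+1) w - X (t i) w)) /\
      (forall s t (B : set R), 0 <= s -> s <= t -> measurable B ->
          P [set w | X t w - X s w \in B] = P [set w | X (t - s) w \in B]) &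
      (forall s kappa, 0 <= s -> 0 < kappa ->
          (\int[P]_w (expR (- kappa * X s w))%:E = (expR (- s * powR kappa alpha))%:E)%E) ].

(* Z_{alpha,gamma} = int_0^oo (1 - A(s))_+^gamma ds, with the integrand read as
   0 where A(s) >= 1 *)
Definition Zag (gamma : R) (X : R -> T -> R) (w : T) : \bar R :=
  (\int[lebesgue_measure]_(s in `[0%R, +oo[%classic)
     (if X s w < 1 then powR (1 - X s w) gamma else 0)%:E)%E.

Definition Aag (alpha gamma : R) (X : R -> T -> R) (t : R) (w : T) : \bar R :=
  ereal_inf (EFin @` [set x : R | 0 <= x /\
     (t%:E < (powR x (alpha + gamma))%:E * Zag gamma X w)%E]).

End Defs.

(* Main.v *)
(* The constants c_n satisfy E Z^n = n! c_n. Indeed Z^n = n! \int_{s_1 < ... < s_n}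
   prod_i (1 - A(s_i))_+^gamma, and integrating out the last time with the independence of the
   increments and the potential measure x^(alpha-1) / Gamma(alpha) dx of the subordinator
   replaces (1 - A(s_n))_+^b by a Beta integral, that is by a constant times
   (1 - A(s_(n-1)))_+^(alpha+b). As c_(n+1) / c_n tends to 0, the law of Z is determined by its
   moments, and E exp(-lambda Z) = sum_n c_n (-lambda)^n is the Kilbas-Saigo function.
   Comparing moments also shows that E g(Z) = E \int_0^1 Z g(Z v) G(v) dv with
   G(v) = (1 - v^(1/theta))^(-alpha) / Gamma(1 - alpha) and
   theta = alpha + gamma, so that Z has a density k. Finally A_{alpha,gamma}(t) = (t / Z)^(1/theta)
   has density h(x, t) = theta t x^(-theta-1) k(t x^(-theta)), and the substitution
   t = x^theta z gives its Laplace transform in t as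
   theta x^(theta-1) E[Z exp(-eta x^theta Z)], the termwise derivative of the series. *)

Require Import Defs.
From HB Require Import structures.
From mathcomp Require Import all_boot all_order all_algebra.
From mathcomp Require Import all_classical all_reals all_analysis.
From mathcomp Require Import measurable_realfun.
From mathcomp Require Import ring lra.
Set Implicit Arguments.
Unset Strict Implicit.
Unset Printing Implicit Defensive.
Import Order.TTheory GRing.Theory Num.Theory.
Import numFieldNormedType.Exports.
Local Open Scope classical_set_scope.
Local Open Scope ring_scope.

(** * Measures with a density *)

(** A Laplace transform known as a series does not by itself produce the density that the statement
    asks for. The factor [G] supplies it: c_n / ((n+1) c_(n+1)) equals theta Gamma((n+1) theta) /
    Gamma(n theta + gamma + 1), which is a Beta integral in disguise, namely the n-th moment of [G].
    Hence E Z^(n+1) times that moment is n! c_n = E Z^n. Since the factor has a density, so has Z: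
    substituting z = Z v gives k(z) = E G(z / Z).

    [gamma] may be negative; the integrand of Z is then unbounded and nothing bounds Z in advance.
    Integrals therefore stay in the extended reals, the exchanges of integrals are by Tonelli, and
    almost sure finiteness of Z is read off its first moment afterwards. The potential measure has
    infinite mass, so uniqueness of Laplace transforms is proved for images under [V] of weighted
    measures that become finite after tilting by exp(-V). *)

Lemma measurable_inv {R : realType} : measurable_fun setT (fun x : R => x^-1).
Proof.
(* The inverse is discontinuous at 0; [powR] is known to be measurable, and the factor [x] restores
   the sign and the value 0 at 0. *)
rewrite (_ : (fun x => _) = (fun x : R => x * (x ^+ 2) `^ (-1))); last first.
  apply/funext => x; have [->|x0] := eqVneq x 0; first by rewrite invr0 mul0r.
  by rewrite powR_inv1 ?sqr_ge0// expr2 invfM mulrA divff ?mul1r.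
apply: measurable_funM => //.
by apply: (measurableT_comp (measurable_powR _)); exact: measurable_funX.
Qed.

Ltac meas :=
  match goal with
  | |- forall _, _ => move=> ?; meas
  | |- _ => solve [done | exact: measurable_cst | exact: measurable_id
                  | exact: measurable_fst | exact: measurable_snd ]
  | |- measurable_fun _ (fun x => EFin (@?f x)) => apply/measurable_EFinP; meas
  | |- measurable_fun _ (fun x => @GRing.add _ (@?f x) (@GRing.opp _ (@?g x))) =>
      apply: (@measurable_funB _ _ _ _ f g); meas
  | |- measurable_fun _ (fun x => @GRing.add _ (@?f x) (@?g x)) =>
      apply: (@measurable_funD _ _ _ _ f g); meas
  | |- measurable_fun _ (fun x => @GRing.opp _ (@?f x)) =>
      apply: (@measurable_funN _ _ _ _ f); meas
  | |- measurable_fun _ (fun x => @GRing.mul _ (@?f x) (@?g x)) =>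
      apply: (@measurable_funM _ _ _ _ f g); meas
  | |- measurable_fun _ (fun x => mule (@?f x) (@?g x)) =>
      apply: (@emeasurable_funM _ _ _ _ f g); meas
  | |- measurable_fun _ (fun x => @GRing.exp _ (@?f x) ?n) =>
      apply: (@measurable_funX _ _ _ _ f n); meas
  | |- measurable_fun _ (fun x => @GRing.inv _ (@?f x)) =>
      apply: (@measurableT_comp _ _ _ _ _ _ _ _ f measurable_inv); meas
  | |- measurable_fun _ (fun x => powR (@?f x) ?p) =>
      apply: (@measurableT_comp _ _ _ _ _ _ (fun y => powR y p) _ f);
        [exact: measurable_powR | meas]
  | |- measurable_fun _ (fun x => expR (@?f x)) =>
      apply: (@measurableT_comp _ _ _ _ _ _ expR _ f); [exact: measurable_expR | meas]
  | |- measurable_fun _ (fun x => fst (@?f x)) =>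
      apply: (@measurableT_comp _ _ _ _ _ _ fst _ f); [exact: measurable_fst | meas]
  | |- measurable_fun _ (fun x => snd (@?f x)) =>
      apply: (@measurableT_comp _ _ _ _ _ _ snd _ f); [exact: measurable_snd | meas]
  | H : measurable_fun setT ?h |- measurable_fun _ (fun x => ?h (@?f x)) =>
      apply: (@measurableT_comp _ _ _ _ _ _ h _ f H); meas
  | |- _ => idtac
  end.

Section WeightedMeasure.
Local Open Scope ereal_scope.
Context d d' (T : measurableType d) (U : measurableType d') (R : realType).
Variables (m : {measure set T -> \bar R}) (W : T -> R) (V : T -> U).
Hypotheses (mW : measurable_fun setT W) (W0 : forall x, (0 <= W x)%R).
Hypothesis mV : measurable_fun setT V.

Let wm (B : set U) : \bar R := \int[m]_(x in V @^-1` B) (W x)%:E.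

Let mpre B : measurable B -> measurable (V @^-1` B).
Proof. by move=> mB; rewrite -[X in measurable X]setTI; exact: mV. Qed.

Let wm0 : wm set0 = 0.
Proof. by rewrite /wm preimage_set0 integral_set0. Qed.

Let wm_ge0 B : 0 <= wm B.
Proof. by apply: integral_ge0 => x _; rewrite lee_fin. Qed.

Let wm_sigma_additive : semi_sigma_additive wm.
Proof.
move=> F mF tF mUF; rewrite /wm preimage_bigcup ge0_integral_bigcup//.
- by apply: is_cvg_nneseries => n _ _; exact: wm_ge0.
- by move=> k; exact: mpre.
- exact/measurable_funTS/measurable_EFinP.
- by move=> x _; rewrite lee_fin.
- apply/trivIsetP => i j _ _ ij; rewrite -preimage_setI.
  by move/trivIsetP: tF => /(_ i j Logic.I Logic.I ij) ->; rewrite preimage_set0.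
Qed.

Import HBNNSimple.

(** This is the image under [V] of the measure with density [W]. Having both operations in one
    object lets the same measure-uniqueness arguments serve substitutions and Laplace transforms.
    The integral formula passes from indicators to simple functions and then to monotone limits, so
    [m] may be any measure. *)
Lemma weighted_measure_exists : exists mu : {measure set U -> \bar R},
  (forall B, measurable B -> mu B = \int[m]_(x in V @^-1` B) (W x)%:E) /\
  forall g : U -> \bar R, measurable_fun setT g -> (forall x, 0 <= g x) ->
    \int[mu]_x g x = \int[m]_x ((W x)%:E * g (V x)).
Proof.
pose mx := isMeasure.Build _ _ _ wm wm0 wm_ge0 wm_sigma_additive.
pose mu : {measure set U -> \bar R} := HB.pack wm mx.
exists mu; split => // g mg g0.
pose h := nnsfun_approx measurableT mg.
have gE x : g x = limn (EFin \o h ^~ x).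
  by apply/esym/cvg_lim => //; exact: cvg_nnsfun_approx.
have -> : \int[mu]_x g x = limn (fun n => \int[mu]_x (h n x)%:E).
  under eq_integral do rewrite gE.
  apply: monotone_convergence => //.
  - by move=> n; exact/measurable_EFinP.
  - by move=> n x _; rewrite lee_fin.
  - by move=> x _ a b ab; rewrite lee_fin; exact/lefP/nd_nnsfun_approx.
have -> : \int[m]_x ((W x)%:E * g (V x)) = limn (fun n => \int[m]_x ((W x)%:E * (h n (V x))%:E)).
  have fg x : (W x)%:E * g (V x) = limn (fun n => (W x)%:E * (h n (V x))%:E).
    have nd : {homo (fun n => (h n (V x))%:E) : a b / (a <= b)%N >-> a <= b}.
      by move=> a b ab; rewrite lee_fin; exact/lefP/nd_nnsfun_approx.
    by rewrite gE -limeMl //; exact: ereal_nondecreasing_is_cvgn.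
  under eq_integral do rewrite fg.
  apply: monotone_convergence => //.
  - move=> n; apply: emeasurable_funM; first exact/measurable_EFinP.
    by apply/measurable_EFinP; exact: measurableT_comp.
  - by move=> n x _; rewrite mule_ge0 ?lee_fin.
  - by move=> x _ a b ab; rewrite lee_wpmul2l ?lee_fin//; exact/lefP/nd_nnsfun_approx.
congr (limn _); apply/funext => n.
transitivity (\int[mu]_x \sum_(y \in range (h n)) (y * \1_(h n @^-1` [set y]) x)%:E).
  by apply: eq_integral => x _; rewrite fimfunE -fsumEFin.
rewrite ge0_integral_fsum//; last 2 first.
- by move=> y; exact/measurable_EFinP/measurable_funM.
- by move=> y x _; rewrite nnfun_muleindic_ge0.
transitivity (\int[m]_x \sum_(y \in range (h n))
    ((y * \1_(h n @^-1` [set y]) (V x))%:E * (W x)%:E)).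
  rewrite [RHS]ge0_integral_fsum//; last 2 first.
  - move=> y; apply: emeasurable_funM; last exact/measurable_EFinP.
    by apply/measurable_EFinP/measurable_funM => //; exact: measurableT_comp.
  - by move=> y x _; rewrite mule_ge0 ?lee_fin//; exact: (nnfun_muleindic_ge0 (h n)).
  apply: eq_fsbigr => r /[!inE] -[t _ rE].
  rewrite integralZl_indic_nnsfun// integral_indic//= setIT.
  under [RHS]eq_integral do rewrite EFinM -muleA.
  rewrite ge0_integralZl//; last 3 first.
  - by apply: emeasurable_funM; last exact/measurable_EFinP; apply/measurable_EFinP; exact: measurableT_comp.
  - by move=> x _; rewrite mule_ge0 ?lee_fin.
  - by rewrite -rE lee_fin.
  congr (_ * _); rewrite /mu /= /wm integral_mkcond.
  apply: eq_integral => x _; rewrite patchE indicE.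
  rewrite (_ : (V x \in h n @^-1` [set r]) = (x \in V @^-1` (h n @^-1` [set r]))) //.
  by case: ifP => _; rewrite ?mul1e ?mul0e.
apply: eq_integral => x _.
rewrite -ge0_mule_fsuml => [|y]; last exact: nnfun_muleindic_ge0.
by rewrite fsumEFin // -(fimfunE _ (V x)) muleC.
Qed.

End WeightedMeasure.

(** * Substitution in Lebesgue integrals *)

Section LebesgueSubstitution.
Local Open Scope ereal_scope.
Context {R : realType}.
Let mu := @lebesgue_measure R.
Implicit Types f h : R -> \bar R.

(** The image under [V] of [W dx] on [D] gives every []a, b]] its length, hence is Lebesgue measure.
    A substitution is thus reduced to one computation on intervals. *)
Lemma integral_lebesgue_transport (D : set R) (W V : R -> R) f : measurable D ->
  measurable_fun setT W -> (forall x, D x -> (0 <= W x)%R) -> measurable_fun setT V ->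
  (forall a b : R, (a < b)%R -> \int[mu]_(x in D `&` V @^-1` `]a, b]) (W x)%:E = (b - a)%:E) ->
  measurable_fun setT f -> (forall x, 0 <= f x) ->
  \int[mu]_(x in D) ((W x)%:E * f (V x)) = \int[mu]_x f x.
Proof.
move=> mD mW W0 mV H mf f0.
have mWD : measurable_fun setT (W \_ D).
  by apply/(measurable_restrictT _ mD)/measurable_funTS.
have WD0 x : (0 <= (W \_ D) x)%R.
  by rewrite patchE; case: ifPn => // /[!inE] /W0.
have [nu [nuE nuI]] := @weighted_measure_exists _ _ (measurableTypeR R) (measurableTypeR R)
  R mu (W \_ D) V mWD WD0 mV.
transitivity (\int[nu]_x f x).
  rewrite nuI// [LHS]integral_mkcond; apply: eq_integral => x _.
  by rewrite !patchE; case: ifP => _ //; rewrite mul0e.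
apply: eq_measure_integral => A mA _.
apply/esym/(@lebesgue_measure_unique R) => //= X [[a b] /= _ <-].
rewrite nuE; last exact: measurable_itv.
transitivity (\int[mu]_(x in D `&` V @^-1` `]a, b]) (W x)%:E); last first.
  rewrite setIC integral_mkcondr; apply: eq_integral => x _.
  by rewrite !patchE; case: ifP.
have [ab|ba] := ltP a b; first by rewrite H// lebesgue_measure_itv/= lte_fin ab.
by rewrite set_itv_ge ?preimage_set0 ?setI0 ?integral_set0 ?measure0// bnd_simp -leNgt.
Qed.

Lemma integral_affine (p q : R) f : p != 0%R ->
  measurable_fun setT f -> (forall x, 0 <= f x) ->
  \int[mu]_x (`|p|%:E * f (p * x + q)%R) = \int[mu]_x f x.
Proof.
move=> p0 mf f0.
apply: (@integral_lebesgue_transport setT (cst `|p|%R) (fun x => p * x + q)%R) => //.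
  by meas.
move=> a b ab; rewrite setTI.
have mI (i : interval R) : measurable ([set` i] : set R) by exact: measurable_itv.
case: (ltgtP p 0%R) p0 => // p0 _.
- have -> : (fun x : R => p * x + q)%R @^-1` `]a, b] = `[((b - q) / p)%R, ((a - q) / p)%R[%classic.
    apply/seteqP; split => x /=; rewrite !in_itv/= ler_ndivrMr// ltr_ndivlMr//; lra.
  rewrite (eq_integral (cst `|p|%:E)) // integral_cst// [X in _ * X]lebesgue_measure_itv/= lte_fin ltr_ndivrMr//.
  rewrite divfK ?lt_eqF// ltrD2r ab -EFinD -EFinM ltr0_norm//; congr EFin.
  by field; rewrite lt_eqF.
- have -> : (fun x : R => p * x + q)%R @^-1` `]a, b] = `]((a - q) / p)%R, ((b - q) / p)%R]%classic.
    apply/seteqP; split => x /=; rewrite !in_itv/= ler_pdivlMr// ltr_pdivrMr//; lra.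
  rewrite (eq_integral (cst `|p|%:E)) // integral_cst// [X in _ * X]lebesgue_measure_itv/= lte_fin ltr_pdivrMr//.
  rewrite divfK ?gt_eqF// ltrD2r ab -EFinD -EFinM gtr0_norm//; congr EFin.
  by field; rewrite gt_eqF.
Qed.

Lemma integral_ln h : measurable_fun setT h -> (forall x, 0 <= h x) ->
  \int[mu]_(x in `]0%R, +oo[) ((x^-1)%:E * h (ln x)) = \int[mu]_x h x.
Proof.
move=> mh h0.
have mI (i : interval R) : measurable ([set` i] : set R) by exact: measurable_itv.
have mV : measurable_fun setT (fun x : R => x^-1)%R by exact: measurable_inv.
apply: (@integral_lebesgue_transport _ (fun x => x^-1)%R (@ln R)) => //.
  by move=> x /=; rewrite in_itv/= andbT invr_ge0 => /ltW.
move=> a b ab.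
have -> : `]0%R, +oo[ `&` @ln R @^-1` `]a, b] = `]expR a, expR b]%classic.
  apply/seteqP; split => x /=; rewrite !in_itv/= andbT.
    by move=> [x0 /andP[]]; rewrite -ltr_expR -ler_expR lnK// => -> ->.
  move=> /andP[ax xb]; have x0 : (0 < x)%R by rewrite (lt_trans _ ax)// expR_gt0.
  by split => //; rewrite -ltr_expR -ler_expR lnK// ax xb.
have eab : (expR a < expR b)%R by rewrite ltr_expR.
have cln x : (expR a <= x)%R -> {for x, continuous (@ln R)}.
  by move=> ax; apply: continuous_ln; rewrite (lt_le_trans _ ax)// expR_gt0.
rewrite integral_itv_obnd_cbnd; last by apply/measurable_funTS/measurable_EFinP.
rewrite (continuous_FTC2 (F := @ln R)) ?expRK//.
- apply: continuous_in_subspaceT => x /[!inE] /=; rewrite in_itv/= => /andP[ax _].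
  by apply: inv_continuous; rewrite gt_eqF// (lt_le_trans _ ax)// expR_gt0.
- split.
  + move=> x; rewrite in_itv/= => /andP[ax _].
    by have [] := is_derive1_ln (lt_trans (expR_gt0 a) ax).
  + exact/cvg_at_right_filter/cln.
  + exact/cvg_at_left_filter/cln/ltW.
- move=> x; rewrite in_itv/= => /andP[ax _].
  by rewrite derive1E; have [] := is_derive1_ln (lt_trans (expR_gt0 a) ax).
Qed.

(** In the variable [u = ln x] the map from [x] to [c * x ^ p] is the affine map [p * u + ln c], so
    this is [integral_affine] conjugated by [integral_ln]. Negative [p] is covered, as the inverse
    process requires. *)
Lemma integral_power (c p : R) f : (0 < c)%R -> p != 0%R ->
  measurable_fun setT f -> (forall x, 0 <= f x) ->
  \int[mu]_(x in `]0%R, +oo[) ((c * `|p| * x `^ (p - 1))%:E * f (c * x `^ p)%R) =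
  \int[mu]_(z in `]0%R, +oo[) f z.
Proof.
move=> c0 p0 mf f0.
pose h (g : R -> \bar R) u := (expR u)%:E * g (expR u).
have mh g : measurable_fun setT g -> measurable_fun setT (h g).
  move=> mg; rewrite /h; meas.
have h0 g : (forall x, 0 <= g x) -> forall u, 0 <= h g u.
  by move=> g0 u; rewrite mule_ge0// lee_fin expR_ge0.
have hE g : measurable_fun setT g -> (forall x, 0 <= g x) ->
    \int[mu]_(x in `]0%R, +oo[) g x = \int[mu]_x h g x.
  move=> mg g0; rewrite -(integral_ln (mh g mg) (h0 g g0)).
  apply: eq_integral => x; rewrite inE/= in_itv/= andbT => x0.
  by rewrite /h lnK// muleA -EFinM mulVf ?mul1e// gt_eqF.
have mg : measurable_fun setT (fun x : R => (c * `|p| * x `^ (p - 1))%:E * f (c * x `^ p)%R).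
  by meas.
rewrite hE//; last first.
  by move=> x; rewrite mule_ge0// lee_fin !mulr_ge0 ?powR_ge0// ltW.
rewrite hE// -(@integral_affine p (ln c) (h f) p0 (mh f mf) (h0 f f0)).
apply: eq_integral => u _; rewrite /h -!expRM muleA -EFinM muleA -EFinM.
have -> : expR (p * u + ln c) = (c * expR (u * p))%R.
  by rewrite expRD lnK// mulrC (mulrC p).
congr (_%:E * _).
rewrite mulrCA (_ : u * p = u + u * (p - 1))%R; last by ring.
by rewrite expRD; ring.
Qed.

End LebesgueSubstitution.

(** * The Gamma and Beta functions *)

Lemma integral_gt0 d (T : measurableType d) (R : realType)
    (m : {measure set T -> \bar R}) (D A : set T) (f : T -> \bar R) :
  measurable D -> measurable A -> A `<=` D -> measurable_fun D f ->
  (forall x, D x -> 0 <= f x)%E -> (forall x, A x -> 0 < f x)%E -> (0 < m A)%E ->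
  (0 < \int[m]_(x in D) f x)%E.
Proof.
move=> mD mA AD mf f0 fA mA0.
rewrite lt_neqAle integral_ge0 ?andbT//; apply/eqP => /esym H.
have /(ae_eq_integral_abs m mD mf)[N [mN N0 AN]] : (\int[m]_(x in D) `|f x| = 0)%E.
  rewrite -H; apply: eq_integral => x /[!inE] Dx; rewrite gee0_abs//.
  exact: f0.
suff : (m A <= m N)%E by rewrite N0 leNgt mA0.
apply: le_measure; rewrite ?inE// => x Ax; apply: AN => /= /(_ (AD _ Ax)) fx.
by have := fA _ Ax; rewrite fx ltxx.
Qed.

Section PositivePower.
Context {R : realType}.
Implicit Types (r s c x y : R).

(* Unlike [powR], this vanishes at nonpositive arguments, whatever the exponent. *)
Definition ppow r y : R := if 0 < y then y `^ r else 0.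

Lemma ppow_gt0E r y : 0 < y -> ppow r y = y `^ r.
Proof. by rewrite /ppow => ->. Qed.

Lemma ppow_le0E r y : y <= 0 -> ppow r y = 0.
Proof. by rewrite /ppow ltNge => ->. Qed.

Lemma ppow_ge0 r y : 0 <= ppow r y.
Proof. by rewrite /ppow; case: ifP => // _; exact: powR_ge0. Qed.

Lemma ppowD r s y : ppow r y * ppow s y = ppow (r + s) y.
Proof.
have [y0|y0] := ltP 0 y; last by rewrite !ppow_le0E// mul0r.
by rewrite !ppow_gt0E// powRD// (lt0r_neq0 y0) implybT.
Qed.

Lemma ppowM r c y : 0 < c -> ppow r (c * y) = c `^ r * ppow r y.
Proof.
move=> c0; have [y0|y0] := ltP 0 y; last by rewrite !ppow_le0E ?mulr0// pmulr_rle0.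
by rewrite !ppow_gt0E ?powRM ?mulr_gt0// ltW.
Qed.

Lemma measurable_ppow r : measurable_fun setT (ppow r).
Proof.
apply: measurable_fun_ifT => //; exact: measurable_fun_ltr.
Qed.

(** Moves the domain into the integrand, so that Tonelli and affine substitutions act on the whole
    line. In particular [ppow 0] is the indicator of the positive half-line and is used as such
    below. *)
Lemma ppow_restrict (f : R -> \bar R) r :
  (\int[lebesgue_measure]_(x in `]0%R, +oo[) ((x `^ r)%:E * f x) =
   \int[lebesgue_measure]_x ((ppow r x)%:E * f x))%E.
Proof.
rewrite integral_mkcond; apply: eq_integral => x _; rewrite patchE.
have [x0|x0] := ltP 0 x.
  by rewrite ifT ?ppow_gt0E// inE/= in_itv/= andbT.
rewrite ppow_le0E// mul0e ifF//; apply/negbTE.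
by rewrite notin_setE/= in_itv/= andbT ltNge x0.
Qed.

End PositivePower.

Section LebesguePower.
Local Open Scope ereal_scope.
Context {R : realType}.
Let mu := @lebesgue_measure R.
Implicit Types f : R -> \bar R.

Lemma integral_ppow (c p : R) f : (0 < c)%R -> p != 0%R ->
  measurable_fun setT f -> (forall x, 0 <= f x) ->
  \int[mu]_x ((c * `|p| * ppow (p - 1) x)%:E * f (c * x `^ p)%R) =
  \int[mu]_z ((ppow 0 z)%:E * f z).
Proof.
move=> c0 p0 mf f0; rewrite -ppow_restrict.
under [RHS]eq_integral do rewrite powRr0 mul1e.
rewrite -(integral_power c0 p0 mf f0).
under [LHS]eq_integral do rewrite (mulrC (c * _)%R) EFinM -muleA.
by rewrite -ppow_restrict; apply: eq_integral => x _; rewrite muleA -EFinM mulrC.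
Qed.

(** The substitution [z = x ^ s] turns this into the length of []0, 1[] divided by [s]. It is also
    the Beta integral with second parameter 1. *)
Lemma integral_ppow01 (s : R) : (0 < s)%R ->
  \int[mu]_x (ppow (s - 1) x * ppow 0 (1 - x))%:E = (s^-1)%:E.
Proof.
move=> s0.
have mp := @measurable_ppow R.
pose f z : \bar R := (ppow 0 (1 - z))%:E.
have mf : measurable_fun setT f by rewrite /f; have := mp 0%R => mp0; meas.
have f0 x : 0 <= f x by rewrite lee_fin ppow_ge0.
have := @integral_ppow 1%R s f ltr01 (lt0r_neq0 s0) mf f0.
have -> : \int[mu]_z ((ppow 0 z)%:E * f z) = 1.
  transitivity (\int[mu]_(z in `]0%R, 1%R[) (cst 1 z)).
    rewrite [RHS]integral_mkcond; apply: eq_integral => z _; rewrite patchE /f -EFinM.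
    case: ifPn => [/[!inE]/=|]; last rewrite notin_setE/=; rewrite in_itv/=.
      by move=> /andP[z0 z1]; rewrite !ppow_gt0E ?subr_gt0// !powRr0 mulr1.
    move=> /negP; rewrite negb_and -!leNgt => /orP[z0|z1].
      by rewrite ppow_le0E// mul0r.
    by rewrite [X in (_ * X)%R]ppow_le0E ?mulr0// subr_le0.
  by rewrite integral_cst// mul1e [LHS]lebesgue_measure_itv/= lte_fin ltr01 sube0.
move=> H; rewrite -[RHS]mule1 -H -ge0_integralZl//; last 3 first.
- by rewrite /f; have := mp (s - 1)%R => mps; have := mp 0%R => mp0; meas.
- by move=> x _; rewrite mule_ge0// lee_fin !mulr_ge0 ?ppow_ge0.
- by rewrite lee_fin invr_ge0 ltW.
apply: eq_integral => x _; rewrite !mul1r muleA -!EFinM gtr0_norm// mulrA mulVf ?gt_eqF// mul1r.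
have [x0|x0] := ltP 0%R x; last by rewrite !(ppow_le0E _ x0) !mul0r.
congr (_ * _)%:E; rewrite /ppow !subr_gt0 !powRr0.
have -> // : (x `^ s < 1)%R = (x < 1)%R.
have p1 : (1 `^ s = 1 :> R)%R by rewrite powR1.
have [x1|x1] := ltP x 1%R.
  by rewrite -p1 (gt0_ltr_powR s0)// nnegrE ltW.
by apply/negbTE; rewrite -leNgt -{1}p1 ge0_ler_powR ?nnegrE ?(ltW s0) ?ler01 ?(ltW x0).
Qed.

End LebesguePower.

Section GammaFunction.
Local Open Scope ereal_scope.
Context {R : realType}.
Let mu := @lebesgue_measure R.
Let mp := @measurable_ppow R.
Implicit Types (s a b k : R).

(** [Gamma] is the [fine] part of this integral and would be 0 if it diverged; finiteness has to be
    proved before the two can be identified. *)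
Let gint s : \bar R := \int[mu]_x (ppow (s - 1) x * expR (- x))%:E.

Lemma integral_exp_decay k : (0 < k)%R ->
  \int[mu]_x (ppow 0 x * expR (- (k * x)))%:E = (k^-1)%:E.
Proof.
move=> k0; have := integral_exponential_pdf k0.
have m1 := measurable_exponential_pdf k.
move=> H; rewrite -[RHS]mule1 -H -ge0_integralZl//; last 3 first.
- by meas.
- by move=> x _; rewrite lee_fin exponential_pdf_ge0// ltW.
- by rewrite lee_fin invr_ge0 ltW.
rewrite [LHS](_ : _ = \int[mu]_(x in `]0%R, +oo[) (expR (- (k * x)))%:E); last first.
  transitivity (\int[mu]_(x in `]0%R, +oo[) ((x `^ 0)%:E * (expR (- (k * x)))%:E)).
    by rewrite ppow_restrict.
  by apply: eq_integral => x _; rewrite powRr0 mul1e.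
rewrite integral_itv_obnd_cbnd; last first.
  by apply: measurable_funTS; meas.
rewrite [LHS]integral_mkcond; apply: eq_integral => x _.
rewrite /exponential_pdf !patchE; case: ifP => _; last by rewrite mule0.
by rewrite -EFinM mulrA mulVf ?gt_eqF// mul1r mulNr.
Qed.

(** The bound [y <= expR y] at [y = x / (2 * p)], raised to the power [p]. Only half of the
    exponential is spent; the other half remains for integrability. *)
Lemma powR_le_exp (p x : R) : (0 < p)%R -> (0 < x)%R ->
  (x `^ p <= (2 * p) `^ p * expR (2^-1 * x))%R.
Proof.
move=> p0 x0.
have -> : expR (2^-1 * x) = (expR (x / (2 * p)) `^ p)%R.
  by rewrite -expRM; congr expR; field; rewrite gt_eqF.
have p20 : (0 <= 2 * p)%R by rewrite mulr_ge0// ltW.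
rewrite -powRM ?expR_ge0//.
have H : (x <= 2 * p * expR (x / (2 * p)))%R.
  rewrite -ler_pdivrMl ?mulr_gt0// mulrC.
  by rewrite (le_trans _ (expR_ge1Dx _))// lerDr.
rewrite ge0_ler_powR ?nnegrE ?(ltW p0)// ?(ltW x0)//.
by rewrite mulr_ge0 ?expR_ge0.
Qed.

Let gint_lty s : (0 < s)%R -> gint s < +oo.
Proof.
(* Below 1 the integrand is at most [x ^ (s - 1)], above 1 at most a multiple of [expR (- x / 2)].
   The maximum with 1 makes the exponent positive, as [powR_le_exp] asks, and only enlarges powers
   of [x >= 1]. *)
move=> s0; pose p : R := Num.max (s - 1)%R 1%R.
have p0 : (0 < p)%R by rewrite /p lt_max ltr01 orbT.
pose C : R := ((2 * p) `^ p)%R; have C0 : (0 <= C)%R by exact: powR_ge0.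
have mp1 := mp (s - 1)%R; have mp0 := mp 0%R.
apply: (@le_lt_trans _ _ (\int[mu]_x ((ppow (s - 1) x * ppow 0 (1 - x))%:E +
   C%:E * (ppow 0 x * expR (- (2^-1 * x)))%:E))).
  apply: ge0_le_integral => //.
  - by move=> x _; rewrite lee_fin mulr_ge0 ?ppow_ge0 ?expR_ge0.
  - by meas.
  - by apply: emeasurable_funD; meas.
  - move=> x _; rewrite -EFinM -EFinD lee_fin.
    have [x0|x0] := ltP 0%R x; last by rewrite !(ppow_le0E _ x0) !mul0r mulr0 addr0.
    have [x1|x1] := ltP x 1%R.
      rewrite (@le_trans _ _ (ppow (s - 1) x * ppow 0 (1 - x)))%R//.
        rewrite ler_wpM2l ?ppow_ge0// ppow_gt0E ?subr_gt0// powRr0.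
        by rewrite -[leRHS]expR0 ler_expR oppr_le0 ltW.
      by rewrite lerDl !mulr_ge0 ?ppow_ge0 ?expR_ge0.
    rewrite (@le_trans _ _ (C * (ppow 0 x * expR (- (2^-1 * x)))))%R//; last first.
      by rewrite lerDr mulr_ge0 ?ppow_ge0.
    rewrite !ppow_gt0E// powRr0 mul1r.
    have -> : expR (- x) = (expR (- (2^-1 * x)) * expR (- (2^-1 * x)))%R.
      by rewrite -expRD; congr expR; field.
    rewrite mulrA ler_wpM2r ?expR_ge0// expRN ler_pdivrMr ?expR_gt0//.
    rewrite (le_trans _ (powR_le_exp p0 x0))// ler_powR//.
    by rewrite /p le_max lexx.
rewrite ge0_integralD//; last 4 first.
- by move=> x _; rewrite lee_fin mulr_ge0 ?ppow_ge0.
- by meas.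
- by move=> x _; rewrite mule_ge0 ?lee_fin// mulr_ge0 ?ppow_ge0 ?expR_ge0.
- by meas.
rewrite integral_ppow01// ge0_integralZl//; last 2 first.
- by meas.
- by move=> x _; rewrite lee_fin mulr_ge0 ?ppow_ge0 ?expR_ge0.
by rewrite integral_exp_decay ?invr_gt0// -EFinM -EFinD ltry.
Qed.

Let gint_gt0 s : 0 < gint s.
Proof.
have mp1 := mp (s - 1)%R.
rewrite /gint.
apply: (@integral_gt0 _ _ _ mu setT `]0%R, 1%R[%classic) => //.
- by meas.
- by move=> x _; rewrite lee_fin mulr_ge0 ?ppow_ge0 ?expR_ge0.
- move=> x /=; rewrite in_itv/= => /andP[x0 _].
  by rewrite lte_fin ppow_gt0E// mulr_gt0 ?powR_gt0 ?expR_gt0.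
- by rewrite [ltRHS]lebesgue_measure_itv/= lte_fin ltr01 sube0 lte_fin.
Qed.

Let Gamma_int s : (0 < s)%R -> (Gamma s)%:E = gint s.
Proof.
move=> s0; rewrite /Gamma /Rintegral.
have -> : \int[mu]_(x in `]0%R, +oo[) (x `^ (s - 1) * expR (- x))%:E = gint s.
  exact: (ppow_restrict (fun x => (expR (- x))%:E)).
by rewrite fineK// ge0_fin_numE ?gint_lty// ltW.
Qed.

Lemma Gamma_gt0 s : (0 < s)%R -> (0 < Gamma s)%R.
Proof. by move=> s0; rewrite -lte_fin Gamma_int. Qed.

Lemma Gamma_integral s k : (0 < s)%R -> (0 < k)%R ->
  \int[mu]_x (ppow (s - 1) x * expR (- (k * x)))%:E = (Gamma s * k `^ (- s))%:E.
Proof.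
move=> s0 k0; have mp1 := mp (s - 1)%R.
rewrite EFinM Gamma_int// /gint.
rewrite -(@integral_affine _ k 0%R (fun x => (ppow (s - 1) x * expR (- x))%:E))
  ?gt_eqF//; last 2 first.
- by meas.
- by move=> x; rewrite lee_fin mulr_ge0 ?ppow_ge0 ?expR_ge0.
rewrite -ge0_integralZr//; last 3 first.
- by meas.
- by move=> x _; rewrite -EFinM lee_fin !mulr_ge0 ?ppow_ge0 ?expR_ge0.
- by rewrite lee_fin powR_ge0.
apply: eq_integral => x _; rewrite addr0 -!EFinM gtr0_norm// ppowM//; congr EFin.
have E : (k * k `^ (s - 1) * k `^ (- s) = 1)%R.
  rewrite -[X in (X * _ * _)%R](powRr1 (ltW k0)) -!powRD ?(lt0r_neq0 k0) ?implybT//.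
  by rewrite (_ : 1 + (s - 1) + - s = 0)%R ?powRr0//; ring.
by rewrite -[LHS]mul1r -[X in (X * _)%R]E; ring.
Qed.

Lemma Gamma1 : Gamma 1 = 1%R :> R.
Proof.
apply: EFin_inj; rewrite Gamma_int//.
have := integral_exp_decay (@ltr01 R); rewrite invr1 => <-.
by apply: eq_integral => x _; rewrite subrr mul1r.
Qed.

Let beta_int a b s := \int[mu]_x (ppow (a - 1) x * ppow (b - 1) (s - x))%:E.

Let beta_int_scale a b s : beta_int a b s = (ppow (a + b - 1) s)%:E * beta_int a b 1.
Proof.
have [s0|s0] := ltP 0%R s; last first.
  rewrite (ppow_le0E _ s0) mul0e /beta_int integral0_eq// => x _.
  have [x0|x0] := ltP 0%R x; last by rewrite (ppow_le0E _ x0) mul0r.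
  by rewrite [X in (_ * X)%R]ppow_le0E ?mulr0//; lra.
have mpa := mp (a - 1)%R; have mpb := mp (b - 1)%R.
rewrite /beta_int -(@integral_affine _ s 0%R) ?gt_eqF//; last 2 first.
- by meas.
- by move=> x; rewrite lee_fin mulr_ge0 ?ppow_ge0.
rewrite -ge0_integralZl; last 4 first.
- exact: measurableT.
- by meas.
- by move=> x _; rewrite lee_fin !mulr_ge0 ?ppow_ge0.
- by rewrite lee_fin ppow_ge0.
apply: eq_integral => x _; rewrite addr0 -!EFinM gtr0_norm//; congr EFin.
have -> : (s - s * x = s * (1 - x))%R by ring.
rewrite !ppowM// (ppow_gt0E _ s0).
have -> : (s `^ (a + b - 1) = s * s `^ (a - 1) * s `^ (b - 1))%R.
  rewrite -[X in (X * _ * _)%R](powRr1 (ltW s0)) -!powRD ?(lt0r_neq0 s0) ?implybT//.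
  by congr powR; ring.
by ring.
Qed.

(** [Gamma a * Gamma b] is a double integral. Taking the sum of the two variables as new variable
    and exchanging the integrals leaves [expR (- s)] times the convolution at [s], which by
    homogeneity is its value at 1 times [s ^ (a + b - 1)]; the remaining integral is
    [Gamma (a + b)]. *)
Lemma Beta_convolution a b s : (0 < a)%R -> (0 < b)%R ->
  \int[mu]_x (ppow (a - 1) x * ppow (b - 1) (s - x))%:E =
  (Gamma a * Gamma b / Gamma (a + b) * ppow (a + b - 1) s)%:E.
Proof.
move=> a0 b0; have ab0 : (0 < a + b)%R by rewrite addr_gt0.
have mpa := mp (a - 1)%R; have mpb := mp (b - 1)%R.
have mpab := mp (a + b - 1)%R.
have pge r x : 0 <= (ppow r x)%:E by rewrite lee_fin ppow_ge0.
have H : (Gamma a * Gamma b)%:E = beta_int a b 1 * (Gamma (a + b))%:E.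
  rewrite (EFinM (Gamma a)) (Gamma_int a0) (Gamma_int b0) (Gamma_int ab0) /gint.
  rewrite -ge0_integralZr; last 4 first.
  - exact: measurableT.
  - by meas.
  - by move=> x _; rewrite lee_fin mulr_ge0 ?ppow_ge0 ?expR_ge0.
  - by apply: integral_ge0 => x _; rewrite lee_fin mulr_ge0 ?ppow_ge0 ?expR_ge0.
  transitivity (\int[mu]_x \int[mu]_s
      (ppow (a - 1) x * ppow (b - 1) (s - x) * expR (- s))%:E).
    apply: eq_integral => x _.
    rewrite -(@integral_affine _ 1%R (- x)%R)//; last 2 first.
    - by meas.
    - by move=> y; rewrite lee_fin mulr_ge0 ?ppow_ge0 ?expR_ge0.
    rewrite -ge0_integralZl//; last 3 first.
    - by meas.
    - by move=> y _; rewrite normr1 mul1e lee_fin mulr_ge0 ?ppow_ge0 ?expR_ge0.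
    - by rewrite lee_fin mulr_ge0 ?ppow_ge0 ?expR_ge0.
    apply: eq_integral => y _; rewrite normr1 mul1e -EFinM mul1r; congr EFin.
    by rewrite mulrACA -expRD; congr (_ * expR _)%R; ring.
  pose F (z : measurableTypeR R * measurableTypeR R) : \bar R :=
    (ppow (a - 1) z.1 * ppow (b - 1) (z.2 - z.1) * expR (- z.2))%:E.
  have mF : measurable_fun setT F by rewrite /F; meas.
  have F0 z : 0 <= F z by rewrite lee_fin !mulr_ge0 ?ppow_ge0 ?expR_ge0.
  rewrite (@fubini_tonelli _ _ _ _ R (@lebesgue_measure R) (@lebesgue_measure R) F mF F0) /F/=.
  rewrite -ge0_integralZl//; last 3 first.
  - by meas.
  - by move=> x _; rewrite lee_fin mulr_ge0 ?ppow_ge0 ?expR_ge0.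
  - by apply: integral_ge0 => x _; rewrite lee_fin mulr_ge0 ?ppow_ge0.
  apply: eq_integral => y _.
  rewrite EFinM muleA (muleC (beta_int _ _ _)) -beta_int_scale /beta_int.
  rewrite -ge0_integralZr//.
  - by meas.
  - by move=> x _; rewrite lee_fin mulr_ge0 ?ppow_ge0.
have G0 := Gamma_gt0 ab0.
rewrite -/(beta_int a b s) beta_int_scale [X in _ * X](_ : _ =
    (Gamma a * Gamma b / Gamma (a + b))%:E); first by rewrite -EFinM mulrC.
by rewrite EFinM H -muleA -EFinM divff ?mule1// gt_eqF.
Qed.

(** The case [b = 1], [s = 1] of the Beta convolution, whose integral is known to be [s^-1]. *)
Lemma GammaD1 s : (0 < s)%R -> Gamma (s + 1) = (s * Gamma s)%R.
Proof.
move=> s0; have := @Beta_convolution s 1%R 1%R s0 ltr01.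
rewrite subrr integral_ppow01// Gamma1 ppow_gt0E// powR1 !mulr1 => -[H].
have G0 := Gamma_gt0 (addr_gt0 s0 ltr01).
apply: (mulfI (invr_neq0 (lt0r_neq0 s0))).
by rewrite mulKf ?gt_eqF// H divfK// gt_eqF.
Qed.

End GammaFunction.

(** * Uniqueness for Laplace transforms *)

Section LaplaceUniqueness.
Context {R : realType}.
Implicit Types (a v x k c : R).

Lemma expRN_le_inv x : 0 < x -> expR (- x) <= x^-1.
Proof.
move=> x0; rewrite expRN lef_pV2 ?posrE ?expR_gt0//.
by rewrite (le_trans _ (expR_ge1Dx x))// lerDr.
Qed.

Lemma bernoulli_ineq x n : 0 <= x -> x <= 1 -> 1 - n%:R * x <= (1 - x) ^+ n.
Proof.
move=> x0 x1; elim: n => [|n ih]; first by rewrite mul0r subr0 expr0.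
rewrite exprS (le_trans _ (ler_wpM2l _ ih))// ?subr_ge0//.
rewrite -natr1; have : 0 <= n%:R * x * x by rewrite !mulr_ge0.
nra.
Qed.

(** Expanding the power gives a combination of exponentials in [v], whose integrals are values of a
    Laplace transform; the limit is the indicator of a ray. The limit is prescribed at [v = a] too,
    so atoms do no harm. *)
Lemma exp_step_approximation a : exists (c : nat -> R) (N : nat -> nat),
  (forall m, 0 <= c m) /\ forall v, 0 <= v ->
  (1 - expR (- (c m * v))) ^+ N m @[m --> \oo] --> (if a < v then 1 else 0 : R).
Proof.
have harm : harmonic @ \oo --> (0 : R) by exact: cvg_harmonic.
have to1 (u : nat -> R) C : (forall m, 1 - C * harmonic m <= u m <= 1) -> u @ \oo --> (1:R).
  move=> H; apply: (@squeeze_cvgr _ _ _ _ (fun m => 1 - C * harmonic m) (fun=> 1)).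
  - by apply: nearW.
  - rewrite -[X in _ --> X]subr0 -(mulr0 C); apply: cvgB; first exact: cvg_cst.
    by apply: cvgM => //; exact: cvg_cst.
  - exact: cvg_cst.
have [a0|age0] := ltP a 0.
  exists (fun=> 0), (fun=> 0%N); split=> // v v0.
  by rewrite (lt_le_trans a0 v0); exact: cvg_cst.
have [a0|an0] := eqVneq a 0.
  exists (fun m => m.+1%:R), (fun=> 1%N); split=> // v v0.
  rewrite a0; have [v1|v1] := ltP 0 v.
    apply: (to1 _ v^-1) => m; rewrite expr1 /harmonic/=.
    rewrite lerD2l lerN2 gerDl oppr_le0 expR_ge0 andbT.
    by rewrite mulrC -invfM (le_trans (expRN_le_inv _)) ?mulr_gt0.
  have -> : v = 0 by apply/eqP; rewrite eq_le v0 andbT.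
  rewrite [X in X @ _](_ : _ = fun=> 0); first exact: cvg_cst.
  by apply/funext => m; rewrite mulr0 oppr0 expR0 subrr expr1.
have a0 : 0 < a by rewrite lt_def an0.
pose L : R := ln 2; have L0 : 0 < L by rewrite ln_gt0// ltr1n.
have L2 m : expR (m%:R * L) = 2 ^+ m by rewrite expRM_natl lnK// posrE.
(* Here [N m * expR (- (c m * v)) = M * 2 ^ (M * (1 - v / a))] with [M = m.+1], which tends
   to [+oo] for [v <= a] and to [0] for [a < v]. *)
exists (fun m => m.+1%:R * L / a), (fun m => m.+1 * 2 ^ m.+1)%N; split.
  by move=> m; rewrite !mulr_ge0 ?invr_ge0// ltW.
move=> v v0.
have y01 m : 0 <= expR (- (m.+1%:R * L / a * v)) <= 1.
  by rewrite expR_ge0 -[leRHS]expR0 ler_expR oppr_le0 !mulr_ge0 ?invr_ge0// ltW.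
have [va|va] := ltP a v.
  pose t := L * (v / a - 1).
  have t0 : 0 < t by rewrite mulr_gt0// subr_gt0 ltr_pdivlMr// mul1r.
  apply: (to1 _ (4 / t ^+ 2)) => m; have /andP[y0 y1] := y01 m.
  rewrite exprn_ile1 ?subr_ge0 ?gerDl ?oppr_le0// andbT.
  rewrite (le_trans _ (bernoulli_ineq _ y0 y1))// lerD2l lerN2.
  rewrite natrM natrX -L2 -mulrA -expRD.
  (* Bernoulli leaves [M * expR (- (M * t))] with [M = m.+1]. Cutting the exponential into two
     halves and bounding each by an inverse gives [4 / (t ^ 2 * M)], which beats the factor [M]. *)
  have -> : m.+1%:R * L + - (m.+1%:R * L / a * v) =
      - (m.+1%:R * t / 2) + - (m.+1%:R * t / 2).
    by rewrite /t; field; rewrite gt_eqF.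
  have h0 : 0 < m.+1%:R * t / 2 by apply: divr_gt0 => //; apply: mulr_gt0.
  rewrite expRD (@le_trans _ _ (m.+1%:R * ((m.+1%:R * t / 2)^-1 * (m.+1%:R * t / 2)^-1)))//.
    by rewrite ler_wpM2l// ler_pM ?expR_ge0// expRN_le_inv.
  rewrite /harmonic/= le_eqVlt; apply/orP; left; apply/eqP; field.
  by rewrite nat1r pnatr_eq0 (gt_eqF t0).
apply: (@squeeze_cvgr _ _ _ _ (fun=> 0) harmonic) => //; last exact: cvg_cst.
apply: nearW => m; have /andP[y0 y1] := y01 m.
rewrite exprn_ge0 ?subr_ge0//=.
(* Here [1 - y <= 1 - 2 ^- M <= expR (- 2 ^- M)], and the power [N = M * 2 ^ M] of the latter is
   [expR (- M)]. *)
have y2 : expR (- (m.+1%:R * L)) <= expR (- (m.+1%:R * L / a * v)).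
  by rewrite ler_expR lerN2 -mulrA -[leRHS]mulr1 ler_wpM2l ?mulr_ge0 ?(ltW L0)// mulrC ler_pdivrMr// mul1r.
rewrite (@le_trans _ _ (expR (- m.+1%:R)))//; last exact: expRN_le_inv.
have -> : - m.+1%:R = - (2 ^+ m.+1)^-1 * (m.+1 * 2 ^ m.+1)%:R :> R.
  by rewrite natrM natrX mulrCA mulNr mulVf ?mulrN1// expf_neq0.
rewrite expRM_natr lerXn2r ?nnegrE ?subr_ge0 ?expR_ge0//.
by rewrite (le_trans _ (expR_ge1Dx _))// lerD2l lerN2 -L2 -expRN.
Qed.

End LaplaceUniqueness.

Section LaplaceUniquenessTheorem.
Local Open Scope ereal_scope.
Context {R : realType}.

Section OneFamily.
Context d (T : measurableType d) (m : {measure set T -> \bar R}) (W V : T -> R).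
Hypotheses (mW : measurable_fun setT W) (mV : measurable_fun setT V).
Hypotheses (W0 : forall x, (0 <= W x)%R) (V0 : forall x, (0 <= V x)%R).
Hypothesis Wfin : forall k : R, (0 < k)%R -> \int[m]_x (W x * expR (- (k * V x)))%:E < +oo.

Let expV_le1 (c : R) x : (0 <= c)%R -> (0 <= 1 - expR (- (c * V x)) <= 1)%R.
Proof.
move=> c0; rewrite subr_ge0 gerDl oppr_le0 expR_ge0 andbT.
by rewrite -[leRHS]expR0 ler_expR oppr_le0 mulr_ge0.
Qed.

(** By the binomial formula this is an alternating sum of Laplace transforms at [k + j * c] for
    [j <= N]. Kept as one nonnegative integral it needs no signed sums of extended reals;
    [laplace_stepS] recovers it recursively from the transform. *)
Definition laplace_step (c k : R) (N : nat) : \bar R :=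
  \int[m]_x (W x * expR (- (k * V x)) * (1 - expR (- (c * V x))) ^+ N)%:E.

Let step_ge0 c k N x : (0 <= c)%R ->
  0 <= (W x * expR (- (k * V x)) * (1 - expR (- (c * V x))) ^+ N)%:E.
Proof.
move=> c0; have /andP[e0 _] := expV_le1 x c0.
by rewrite lee_fin !mulr_ge0 ?expR_ge0// exprn_ge0.
Qed.

Lemma laplace_step_ge0 c k N : (0 <= c)%R -> 0 <= laplace_step c k N.
Proof. by move=> c0; apply: integral_ge0 => x _; exact: step_ge0. Qed.

Lemma laplace_step_lty c k N : (0 <= c)%R -> (0 < k)%R -> laplace_step c k N < +oo.
Proof.
move=> c0 k0; apply: le_lt_trans (Wfin k0); apply: ge0_le_integral => //.
- by move=> x _; exact: step_ge0.
- by meas.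
- by meas.
- move=> x _; have /andP[e0 e1] := expV_le1 x c0.
  by rewrite lee_fin ler_piMr ?mulr_ge0 ?expR_ge0// exprn_ile1.
Qed.

Lemma laplace_stepS c k N : (0 <= c)%R ->
  laplace_step c k N.+1 + laplace_step c (k + c) N = laplace_step c k N.
Proof.
move=> c0; rewrite /laplace_step -ge0_integralD//.
- apply: eq_integral => x _; rewrite -EFinD; congr EFin.
  rewrite (_ : (- ((k + c) * V x)) = - (k * V x) + - (c * V x))%R; last by ring.
  by rewrite expRD exprS; ring.
- by move=> x _; exact: step_ge0.
- by meas.
- by move=> x _; exact: step_ge0.
- by meas.
Qed.

Lemma laplace_step_cvg (c : nat -> R) (N : nat -> nat) (a : R) : (forall n, (0 <= c n)%R) ->
  (forall v, (0 <= v)%R ->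
    ((1 - expR (- (c n * v))) ^+ N n @[n --> \oo] --> (if a < v then 1 else 0 : R))%R) ->
  laplace_step (c n) 1 (N n) @[n --> \oo] -->
  \int[m]_(x in V @^-1` `]a, +oo[) (W x * expR (- V x))%:E.
Proof.
move=> c0 H.
rewrite integral_mkcond.
apply: (@dominated_cvg _ _ _ m setT measurableT
  (fun n x => (W x * expR (- (1 * V x)) * (1 - expR (- (c n * V x))) ^+ N n)%:E)
  _ (fun x => (W x * expR (- (1 * V x)))%:E)) => //.
- by move=> n; meas.
- move=> x _; rewrite patchE.
  have -> : (if x \in V @^-1` `]a, +oo[ then (W x * expR (- V x))%:E else 0) =
     (W x * expR (- (1 * V x)) * (if (a < V x)%R then 1 else 0))%:E :> \bar R.
    have -> : (x \in V @^-1` `]a, +oo[) = (a < V x)%R.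
      by apply/idP/idP; rewrite inE/= in_itv/= andbT.
    rewrite mul1r.
    by case: ifP; rewrite ?mulr1 ?mulr0.
  apply/cvg_EFin; first by apply: nearW.
  by apply: cvgM; [exact: cvg_cst|exact: H].
- apply/integrableP; split; first by meas.
  under eq_integral do rewrite gee0_abs ?lee_fin ?mulr_ge0 ?expR_ge0//.
  exact: Wfin.
- move=> n x _; have /andP[e0 e1] := expV_le1 x (c0 n).
  rewrite gee0_abs ?step_ge0// lee_fin ler_piMr ?mulr_ge0 ?expR_ge0//.
  exact: exprn_ile1.
Qed.

End OneFamily.

(** The weights may have infinite total mass, so the images of [W * expR (- V)] are compared; they
    are finite by the hypothesis at [k = 1]. The step approximations show that they agree on rays,
    hence on all Borel sets. *)
Lemma laplace_unique d1 d2 (T1 : measurableType d1) (T2 : measurableType d2)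
    (m1 : {measure set T1 -> \bar R}) (m2 : {measure set T2 -> \bar R})
    (W1 V1 : T1 -> R) (W2 V2 : T2 -> R) :
  measurable_fun setT W1 -> measurable_fun setT V1 ->
  measurable_fun setT W2 -> measurable_fun setT V2 ->
  (forall x, (0 <= W1 x)%R) -> (forall x, (0 <= V1 x)%R) ->
  (forall x, (0 <= W2 x)%R) -> (forall x, (0 <= V2 x)%R) ->
  (forall k : R, (0 < k)%R -> \int[m1]_x (W1 x * expR (- (k * V1 x)))%:E < +oo) ->
  (forall k : R, (0 < k)%R -> \int[m1]_x (W1 x * expR (- (k * V1 x)))%:E =
                         \int[m2]_x (W2 x * expR (- (k * V2 x)))%:E) ->
  forall g : R -> \bar R, measurable_fun setT g -> (forall x, 0 <= g x) ->
  \int[m1]_x ((W1 x)%:E * g (V1 x)) = \int[m2]_x ((W2 x)%:E * g (V2 x)).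
Proof.
move=> mW1 mV1 mW2 mV2 W10 V10 W20 V20 fin1 eq12 g mg g0.
have fin2 k : (0 < k)%R -> \int[m2]_x (W2 x * expR (- (k * V2 x)))%:E < +oo.
  by move=> k0; rewrite -eq12// fin1.
have step12 c N : (0 <= c)%R -> forall k, (0 < k)%R ->
    laplace_step m1 W1 V1 c k N = laplace_step m2 W2 V2 c k N.
  move=> c0; elim: N => [|N ih] k k0.
    rewrite /laplace_step; under eq_integral do rewrite expr0 mulr1.
    by under [RHS]eq_integral do rewrite expr0 mulr1; exact: eq12.
  have kc0 : (0 < k + c)%R by rewrite ltr_wpDr.
  have fin : laplace_step m2 W2 V2 c (k + c) N \is a fin_num.
    by rewrite ge0_fin_numE ?laplace_step_ge0// laplace_step_lty.
  have := laplace_stepS m1 mW1 mV1 W10 V10 k N c0.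
  (* Both recursions have the same value on the right, and the common term at [k + c] is finite, so
     it can be cancelled. *)
  rewrite ih// ih// -(laplace_stepS m2 mW2 mV2 W20 V20 k N c0) => E.
  by rewrite -[LHS](addeK _ fin) E addeK.
pose D1 x := (W1 x * expR (- V1 x))%R; pose D2 x := (W2 x * expR (- V2 x))%R.
have mD1 : measurable_fun setT D1 by rewrite /D1; meas.
have mD2 : measurable_fun setT D2 by rewrite /D2; meas.
have D10 x : (0 <= D1 x)%R by rewrite mulr_ge0 ?expR_ge0.
have D20 x : (0 <= D2 x)%R by rewrite mulr_ge0 ?expR_ge0.
have [mu1 [mu1E mu1I]] := @weighted_measure_exists _ _ _ (measurableTypeR R) _ m1 _ _ mD1 D10 mV1.
have [mu2 [mu2E mu2I]] := @weighted_measure_exists _ _ _ (measurableTypeR R) _ m2 _ _ mD2 D20 mV2.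
have rays a : mu1 `]a, +oo[%classic = mu2 `]a, +oo[%classic.
  have [c [N [c0 cN]]] := exp_step_approximation a.
  rewrite mu1E ?mu2E; [|exact: measurable_itv..].
  have H1 := laplace_step_cvg mW1 mV1 W10 V10 fin1 c0 cN.
  have H2 := laplace_step_cvg mW2 mV2 W20 V20 fin2 c0 cN.
  have E : (fun n => laplace_step m1 W1 V1 (c n) 1 (N n)) =
      (fun n => laplace_step m2 W2 V2 (c n) 1 (N n)).
    by apply/funext => n; exact: step12.
  by rewrite E in H1; exact: (cvg_unique _ H1 H2).
have mu12 A : measurable A -> mu1 A = mu2 A.
  move=> mA.
  refine (@measure_unique _ R (measurableTypeR R) (@RGenOInfty.G R)
    (fun n => `](- n%:R)%R, +oo[%classic) _ _ _ _ mu1 mu2 _ _ A mA) => //.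
  - exact: RGenOInfty.measurableE.
  - move=> _ _ [a ->] [b ->]; exists (Num.max a b).
    by apply/seteqP; split=> x /=; rewrite !in_itv/= !andbT gt_max => /andP.
  - by move=> n; exists (- n%:R)%R.
  - apply/seteqP; split=> // x _.
    exists (Num.truncn `|x|).+1 => //=; rewrite in_itv/= andbT ltrNl.
    by rewrite (le_lt_trans (ler_norm _))// normrN truncnS_gt.
  - by move=> _ [a ->]; exact: rays.
  - move=> n; rewrite mu1E; last exact: measurable_itv.
    have := fin1 1%R ltr01; apply: le_lt_trans; rewrite [leRHS](_ : _ = \int[m1]_x (D1 x)%:E).
      apply: ge0_subset_integral => //.
      + by rewrite -[X in measurable X]setTI; apply: (mV1 measurableT); exact: measurable_itv.
      + exact/measurable_EFinP.
      + by move=> x _; rewrite lee_fin.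
    by apply: eq_integral => x _; rewrite mul1r.
(* Undoes the tilt: against the tilted images, [g] is replaced by [g] times the exponential. *)
pose h x : \bar R := g x * (expR x)%:E.
have mh : measurable_fun setT h by rewrite /h; meas.
have h0 x : 0 <= h x by rewrite mule_ge0 ?lee_fin ?expR_ge0.
transitivity (\int[mu1]_x h x).
  rewrite mu1I//; apply: eq_integral => x _; rewrite /h /D1 [in RHS]muleCA -EFinM.
  by rewrite -mulrA -expRD addNr expR0 mulr1 muleC.
transitivity (\int[mu2]_x h x); last first.
  rewrite mu2I//; apply: eq_integral => x _; rewrite /h /D2 [in LHS]muleCA -EFinM.
  by rewrite -mulrA -expRD addNr expR0 mulr1 muleC.
by apply: eq_measure_integral => A mA _; exact: mu12.
Qed.

End LaplaceUniquenessTheorem.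

(** * From moments to Laplace transforms *)

Section MomentsLaplace.
Context {R : realType} d (T : measurableType d) (m : {measure set T -> \bar R}).
Variables (W V : T -> R) (b : nat -> R).
Hypotheses (mW : measurable_fun setT W) (mV : measurable_fun setT V).
Hypotheses (W0 : forall x, 0 <= W x) (V0 : forall x, 0 <= V x).
Hypothesis moments :
  forall n, (\int[m]_x (W x * V x ^+ n)%:E = (n`!%:R * b n)%:E)%E.
Hypothesis cvg_b : forall c : R, 0 <= c -> cvgn (series (fun n => b n * c ^+ n)).

Let moment_integrable n : m.-integrable setT (fun x => (W x * V x ^+ n)%:E).
Proof.
apply/integrableP; split; first by meas.
under eq_integral do rewrite gee0_abs ?lee_fin ?mulr_ge0 ?exprn_ge0//.
by rewrite moments ltry.
Qed.

Let partial (s : R) N x := W x * series (exp_coeff (s * V x)) N.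

Let mpartial s N : measurable_fun setT (fun x => (partial s N x)%:E).
Proof.
apply/measurable_EFinP; rewrite /partial; apply: measurable_funM => //.
rewrite /series /=; apply: measurable_sum => i.
by rewrite /exp_coeff /=; meas.
Qed.

Let integral_partial s N :
  (\int[m]_x (partial s N x)%:E = (series (fun n => b n * s ^+ n) N)%:E)%E.
Proof.
pose h (i : nat) x := ((s ^+ i / i`!%:R)%:E * (W x * V x ^+ i)%:E)%E.
transitivity (\int[m]_x (\sum_(0 <= i < N) h i x)%E)%E.
  apply: eq_integral => x _; rewrite /partial /h /series /= mulr_sumr -sumEFin.
  apply: eq_bigr => i _; rewrite -EFinM /exp_coeff /= exprMn; congr EFin; ring.
rewrite integral_sum//; last first.
  by move=> i; rewrite /h; apply: integrableZl => //; exact: moment_integrable.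
rewrite /series /= -sumEFin; apply: eq_bigr => i _.
rewrite /h integralZl// moments -EFinM; congr EFin.
by field; rewrite pnatr_eq0 -lt0n fact_gt0.
Qed.

(** By monotone convergence the integral is the sum of [b n * s ^+ n], finite by [cvg_b]. *)
Let exp_integrable s : 0 <= s -> m.-integrable setT (fun x => (W x * expR (s * V x))%:E).
Proof.
move=> s0; have mf : measurable_fun setT (fun x => (W x * expR (s * V x))%:E) by meas.
apply/integrableP; split => //.
under eq_integral do rewrite gee0_abs ?lee_fin ?mulr_ge0 ?expR_ge0//.
have lim x : (W x * expR (s * V x))%:E = limn (fun N => (partial s N x)%:E).
  apply/esym/cvg_lim => //; apply/cvg_EFin; first by apply: nearW.
  by apply: cvgM; [exact: cvg_cst|exact: is_cvg_series_exp_coeff].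
under eq_integral do rewrite lim.
rewrite monotone_convergence//; last 2 first.
- move=> N x _; rewrite lee_fin mulr_ge0// /series/= sumr_ge0// => i _.
  by rewrite /exp_coeff/= mulr_ge0 ?exprn_ge0 ?mulr_ge0.
- move=> x _ i j ij; rewrite lee_fin ler_wpM2l//.
  have : {homo series (exp_coeff (s * V x)) : i j / (i <= j)%N >-> i <= j}.
    by apply: nondecreasing_series => k _ _; rewrite /exp_coeff/= mulr_ge0 ?exprn_ge0 ?mulr_ge0.
  exact.
under eq_fun do rewrite integral_partial.
rewrite (_ : limn _ = (limn (series (fun n => b n * s ^+ n)))%:E) ?ltry//.
by apply/cvg_lim => //; apply/cvg_EFin; [exact: nearW|exact: cvg_b].
Qed.

(** The partial sums of the alternating exponential series are dominated by [W * expR (s * V)],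
    which is integrable because the moments grow slowly enough; so the series may be integrated term
    by term. *)
Lemma laplace_of_moments s : 0 <= s ->
  (\int[m]_x (W x * expR (- (s * V x)))%:E =
   (limn (series (fun n => b n * (- s) ^+ n)))%:E)%E.
Proof.
move=> s0.
have H : ((\int[m]_x (partial (- s) N x)%:E)%E @[N --> \oo] -->
    (\int[m]_x (W x * expR (- s * V x))%:E)%E).
  apply: (@dominated_cvg _ _ _ m setT measurableT (fun N x => (partial (- s) N x)%:E) _
    (fun x => (W x * expR (s * V x))%:E)) => //.
  - move=> x _; apply/cvg_EFin; first by apply: nearW.
    by apply: cvgM; [exact: cvg_cst|exact: is_cvg_series_exp_coeff].
  - exact: exp_integrable.
  - move=> N x _; rewrite abse_EFin lee_fin normrM (ger0_norm (W0 x)) ler_wpM2l//.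
    apply: (@le_trans _ _ (series (exp_coeff (s * V x)) N)).
      rewrite /series/= (le_trans (ler_norm_sum _ _ _))// ler_sum// => i _.
      rewrite /exp_coeff/= normrM normrX normrM normrN (ger0_norm s0) (ger0_norm (V0 x)).
      by rewrite ger0_norm ?invr_ge0.
    apply: nondecreasing_cvgn_le; last exact: is_cvg_series_exp_coeff.
    by apply: nondecreasing_series => k _ _; rewrite /exp_coeff/= mulr_ge0 ?exprn_ge0 ?mulr_ge0.
have E : (\int[m]_x (W x * expR (- (s * V x)))%:E = \int[m]_x (W x * expR (- s * V x))%:E)%E.
  by apply: eq_integral => x _; rewrite mulNr.
have fin : (\int[m]_x (W x * expR (- s * V x))%:E)%E \is a fin_num.
  rewrite ge0_fin_numE; last by apply: integral_ge0 => x _; rewrite lee_fin mulr_ge0 ?expR_ge0.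
  rewrite -E; have /integrableP[_] := moment_integrable 0%N.
  apply: le_lt_trans; apply: ge0_le_integral => //.
  - by move=> x _; rewrite lee_fin mulr_ge0 ?expR_ge0.
  - by meas.
  - by apply: measurableT_comp => //; meas.
  - move=> x _; rewrite expr0 mulr1 abse_EFin lee_fin ger0_norm// ler_piMr//.
    by rewrite -[leRHS]expR0 ler_expR oppr_le0 mulr_ge0.
rewrite E.
have HE : (fun N => (\int[m]_x (partial (- s) N x)%:E)%E) =
    (fun N => (series (fun n => b n * (- s) ^+ n) N)%:E).
  by apply/funext => N; exact: integral_partial.
rewrite HE -(fineK fin) in H; rewrite -(fineK fin); congr EFin; apply/esym/cvg_lim => //.
by move/fine_cvgP : H => [].
Qed.

End MomentsLaplace.

Lemma moments_unique (R : realType) d1 d2 (T1 : measurableType d1) (T2 : measurableType d2)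
    (m1 : {measure set T1 -> \bar R}) (m2 : {measure set T2 -> \bar R})
    (W1 V1 : T1 -> R) (W2 V2 : T2 -> R) (b : nat -> R) :
  measurable_fun setT W1 -> measurable_fun setT V1 ->
  measurable_fun setT W2 -> measurable_fun setT V2 ->
  (forall x, 0 <= W1 x) -> (forall x, 0 <= V1 x) ->
  (forall x, 0 <= W2 x) -> (forall x, 0 <= V2 x) ->
  (forall n, \int[m1]_x (W1 x * V1 x ^+ n)%:E = (n`!%:R * b n)%:E)%E ->
  (forall n, \int[m2]_x (W2 x * V2 x ^+ n)%:E = (n`!%:R * b n)%:E)%E ->
  (forall c : R, 0 <= c -> cvgn (series (fun n => b n * c ^+ n))) ->
  forall g : R -> \bar R, measurable_fun setT g -> (forall x, 0 <= g x)%E ->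
  (\int[m1]_x ((W1 x)%:E * g (V1 x)) = \int[m2]_x ((W2 x)%:E * g (V2 x)))%E.
Proof.
move=> mW1 mV1 mW2 mV2 W10 V10 W20 V20 M1 M2 cb.
by apply: laplace_unique => // k /ltW k0; rewrite !(laplace_of_moments (b := b))// ltry.
Qed.

(** * The potential measure of the stable subordinator *)

Section Subordinator.
Context (R : realType) (d : measure_display) (T : measurableType d)
  (P : probability T R) (alpha : R) (X : R -> T -> R).
Hypotheses (alpha0 : 0 < alpha) (alpha1 : alpha < 1).
Hypothesis SS : stable_subordinator P alpha X.
Let leb := @lebesgue_measure R.

Lemma subordinator_measurable s : measurable_fun setT (X s).
Proof. by case: SS => -[]. Qed.

Lemma subordinator0 w : X 0 w = 0.
Proof. by case: SS => -[]. Qed.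

Lemma subordinator_ge0 s w : 0 <= s -> 0 <= X s w.
Proof. by case: SS => -[_ X0] nd _ _ _ s0; rewrite -(X0 w) nd. Qed.

(** The paths are controlled at nonnegative times only. Freezing the process at its initial value
    before 0 gives a process on the whole line that is jointly measurable. *)
Definition Xpos (r : R) (w : T) : R := X (Num.max 0 r) w.

Lemma XposE r w : 0 <= r -> Xpos r w = X r w.
Proof. by move=> r0; rewrite /Xpos max_r. Qed.

Lemma Xpos_ge0 r w : 0 <= Xpos r w.
Proof. by apply: subordinator_ge0; rewrite le_max lexx. Qed.

(** The next point of the grid of mesh [1 / (n + 1)], strictly to the right of the time: [at_right]
    excludes the point itself. Sampling there gives countably valued times, and right-continuity
    gives the limit. *)
Let time (n : nat) (r : R) : R := (Num.truncn (Num.max 0 r * n.+1%:R)).+1%:R / n.+1%:R.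

Let time_gt n r : Num.max 0 r < time n r.
Proof. by rewrite /time ltr_pdivlMr// truncnS_gt. Qed.

Let time_cvg r : time n r @[n --> \oo] --> Num.max 0 r.
Proof.
have m0 : 0 <= Num.max 0 r by rewrite le_max lexx.
apply: (@squeeze_cvgr _ _ _ _ (fun=> Num.max 0 r)
    (fun n => Num.max 0 r + harmonic n)).
- apply: nearW => n; rewrite ltW//= /time /harmonic/= ler_pdivrMr//.
  rewrite mulrDl mulVf// -natr1 lerD2r truncn_le mulr_ge0//.
- exact: cvg_cst.
- rewrite -[X in _ --> X]addr0; apply: cvgD; first exact: cvg_cst.
  exact: cvg_harmonic.
Qed.

Lemma measurable_Xpos :
  measurable_fun setT (fun z : measurableTypeR R * T => Xpos z.1 z.2).
Proof.
have [_ _ rc _ _] := SS.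
apply: (@measurable_fun_cvg _ _ _ setT (fun n z => X (time n z.1) z.2)).
- move=> n _ B mB; rewrite setTI.
  pose A k := [set r : R | Num.truncn (Num.max 0 r * n.+1%:R) = k].
  have -> : (fun z : measurableTypeR R * T => X (time n z.1) z.2) @^-1` B =
      \bigcup_k (A k `*` X (k.+1%:R / n.+1%:R) @^-1` B).
    apply/seteqP; split => [[r w] /= H|[r w] [k _ [/= <-]]//].
    by exists (Num.truncn (Num.max 0 r * n.+1%:R)).
  apply: bigcup_measurable => k _; apply: measurableX; last first.
    rewrite -[X in measurable X]setTI.
    exact: (subordinator_measurable _ measurableT mB).
  have -> : A k = (fun r : R => Num.max 0 r * n.+1%:R) @^-1` `[k%:R, k.+1%:R[.
    apply/seteqP; split=> r; rewrite /A/= in_itv/=.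
      by move=> <-; apply: truncn_itv; rewrite mulr_ge0// le_max lexx.
    by move=> H; apply: truncn_def.
  rewrite -[X in measurable X]setTI.
  have mf : measurable_fun setT (fun r : R => Num.max 0 r * n.+1%:R).
    by apply: measurable_funM => //; exact: measurable_maxr.
  by apply: (mf measurableT); exact: measurable_itv.
- move=> [r w] _ /=; rewrite /Xpos.
  have m0 : 0 <= Num.max 0 r by rewrite le_max lexx.
  have H : time n r @[n --> \oo] --> at_right (Num.max 0 r).
    move=> B [e /= e0 eB].
    have := @cvgr_dist_lt _ _ _ _ _ _ _ (time_cvg (r := r)) e e0.
    move=> [N _ NB]; exists N => // n Nn; apply: eB; last exact: time_gt.
    exact: NB.
  exact: (cvg_comp _ _ H (rc w _ m0)).
Qed.

Lemma laplace_Xpos r k : 0 < r -> 0 < k ->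
  (\int[P]_w (expR (- (k * Xpos r w)))%:E = (expR (- (k `^ alpha * r)))%:E)%E.
Proof.
move=> r0 k0; have [_ _ _ _ lap] := SS.
rewrite mulrC -mulNr -(lap r k (ltW r0) k0); apply: eq_integral => w _.
by rewrite XposE ?(ltW r0)// mulNr.
Qed.

(** Integrating [E expR (- k X_r) = expR (- r k ^ alpha)] over [r > 0] gives [k ^ (- alpha)], which
    by [Gamma_integral] is also the Laplace transform of the density on the right. The infinite mass
    is harmless, as uniqueness asks for finiteness at [k > 0] only. *)
Lemma subordinator_potential (g : R -> \bar R) :
  measurable_fun setT g -> (forall x, 0 <= g x)%E ->
  (\int[leb]_r ((ppow 0 r)%:E * \int[P]_w g (Xpos r w)) =
   \int[leb]_x ((ppow (alpha - 1) x / Gamma alpha)%:E * g x))%E.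
Proof.
move=> mg g0.
have mX := measurable_Xpos.
have mp := @measurable_ppow R.
have mp0 := mp 0; have mpa := mp (alpha - 1).
have G0 := Gamma_gt0 alpha0.
pose W1 (z : measurableTypeR R * T) : R := ppow 0 z.1.
pose V1 (z : measurableTypeR R * T) : R := Xpos z.1 z.2.
pose W2 (x : measurableTypeR R) : R := ppow (alpha - 1) x / Gamma alpha.
(* The maximum makes [V2] nonnegative, as uniqueness demands; it changes [x] only where [W2]
   vanishes. *)
pose V2 (x : measurableTypeR R) : R := Num.max 0 x.
have mW1 : measurable_fun setT W1 by rewrite /W1; meas.
have mW2 : measurable_fun setT W2 by rewrite /W2; meas.
have mV2 : measurable_fun setT V2 by exact: measurable_maxr.
have W10 z : 0 <= W1 z by exact: ppow_ge0.
have W20 z : 0 <= W2 z by rewrite mulr_ge0 ?ppow_ge0 ?invr_ge0 ?ltW.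
have V10 z : 0 <= V1 z by exact: Xpos_ge0.
have V20 z : 0 <= V2 z by rewrite le_max lexx.
have tonelli (f : R -> \bar R) : measurable_fun setT f -> (forall x, 0 <= f x)%E ->
    (\int[leb \x P]_z ((W1 z)%:E * f (V1 z)) =
     \int[leb]_r ((ppow 0 r)%:E * \int[P]_w f (Xpos r w)))%E.
  move=> mf f0.
  pose F z := ((W1 z)%:E * f (V1 z))%E.
  have mF : measurable_fun setT F by rewrite /F; meas.
  have F0 z : (0 <= F z)%E by rewrite mule_ge0 ?lee_fin.
  rewrite (@fubini_tonelli1 _ _ _ _ R (@lebesgue_measure R) P F mF F0); apply: eq_integral => r _.
  rewrite /fubini_F /F /W1 /V1 /= ge0_integralZl//; last by rewrite lee_fin ppow_ge0.
  by apply: (measurableT_comp mf); exact: subordinator_measurable.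
have lap2 k : 0 < k -> (\int[leb]_x (W2 x * expR (- (k * V2 x)))%:E = (k `^ (- alpha))%:E)%E.
  move=> k0; transitivity (\int[leb]_x ((Gamma alpha)^-1%:E *
     (ppow (alpha - 1) x * expR (- (k * x)))%:E))%E.
    apply: eq_integral => x _; rewrite -EFinM /W2; congr EFin.
    have [x0|x0] := ltP 0 x; last by rewrite ppow_le0E// !(mul0r, mulr0).
    by rewrite /V2 max_r ?(ltW x0)//; ring.
  rewrite ge0_integralZl//; last 3 first.
  - by meas.
  - by move=> x _; rewrite lee_fin mulr_ge0 ?ppow_ge0 ?expR_ge0.
  - by rewrite lee_fin invr_ge0 ltW.
  by rewrite Gamma_integral// -EFinM mulrA mulVf ?mul1r// gt_eqF.
have lap1 k : 0 < k ->
    (\int[leb \x P]_z (W1 z * expR (- (k * V1 z)))%:E = (k `^ (- alpha))%:E)%E.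
  move=> k0; transitivity (\int[leb \x P]_z ((W1 z)%:E * (expR (- (k * V1 z)))%:E))%E.
    by apply: eq_integral => z _; rewrite EFinM.
  rewrite (tonelli (fun x => (expR (- (k * x)))%:E)); last 2 first.
  - by meas.
  - by move=> x; rewrite lee_fin expR_ge0.
  rewrite powRN -integral_exp_decay ?powR_gt0//.
  apply: eq_integral => r _; have [r0|r0] := ltP 0 r; last first.
    by rewrite ppow_le0E// mul0r mul0e.
  by rewrite laplace_Xpos.
rewrite -tonelli// (@laplace_unique _ _ _ _ _ (leb \x P)%E leb W1 V1 W2 V2)//; last 2 first.
- by move=> k k0; rewrite lap1// ltry.
- by move=> k k0; rewrite lap1// lap2.
apply: eq_integral => x _; rewrite /W2 /V2.
have [x0|x0] := ltP 0 x; last by rewrite ppow_le0E// mul0r !mul0e.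
by [].
Qed.

End Subordinator.

(** * Powers of a tail integral *)

Section TailPower.
Local Open Scope ereal_scope.
Context {R : realType}.
Let leb := @lebesgue_measure R.
Variable phi : R -> \bar R.
Hypotheses (mphi : measurable_fun setT phi) (phi0 : forall s, 0 <= phi s).

Definition tail_integral (f : R -> \bar R) (t : R) : \bar R :=
  \int[leb]_s ((ppow 0 (s - t))%:E * f s).

Lemma tail_integral_ge0 f t : (forall s, 0 <= f s) -> 0 <= tail_integral f t.
Proof. by move=> f0; apply: integral_ge0 => s _; rewrite mule_ge0// lee_fin ppow_ge0. Qed.

Lemma measurable_tail_integral f : measurable_fun setT f -> (forall s, 0 <= f s) ->
  measurable_fun setT (tail_integral f).
Proof.
move=> mf f0; have mp := @measurable_ppow R 0%R.
pose F (z : measurableTypeR R * measurableTypeR R) :=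
  (ppow 0 (z.2 - z.1))%:E * f z.2.
have mF : measurable_fun setT F by rewrite /F; meas.
have F0 z : 0 <= F z by rewrite mule_ge0// lee_fin ppow_ge0.
exact: (@measurable_fun_fubini_tonelli_F _ _ _ _ R (@lebesgue_measure R) F mF F0).
Qed.

Section Opaque.
Variable F : R -> \bar R.
Hypothesis FE : forall t, F t = tail_integral phi t.

Let F0 s : 0 <= F s. Proof. by rewrite FE; exact: tail_integral_ge0. Qed.
Let mF : measurable_fun setT F.
Proof. by rewrite (funext FE); exact: measurable_tail_integral. Qed.

Let mFn n : measurable_fun setT (fun s => F s ^+ n).
Proof.
elim: n => [|n ih]; first by under eq_fun do rewrite expe0; exact: measurable_cst.
by under eq_fun do rewrite expeS; exact: emeasurable_funM.
Qed.

Let Fn0 n s : 0 <= F s ^+ n. Proof. exact: expe_ge0. Qed.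

Let mA n : measurable_fun setT (fun s => phi s * F s ^+ n).
Proof. by apply: emeasurable_funM. Qed.

Let A0 n s : 0 <= phi s * F s ^+ n. Proof. exact: mule_ge0. Qed.

(* Tonelli on the square [u > t, s > t], split along its diagonal: one half is the
   next iterated integral by induction, the other one directly. *)
Lemma tail_integral_pow_eq n t :
  F t ^+ n.+1 = n.+1%:R%:E * tail_integral (fun s => phi s * F s ^+ n) t.
Proof.
have mp := @measurable_ppow R 0%R.
have p0 (x : R) : 0 <= (ppow 0 x)%:E by rewrite lee_fin ppow_ge0.
elim: n t => [|n ih] t.
  rewrite expeS expe0 mule1 mul1e FE /tail_integral.
  by apply: eq_integral => s _; rewrite expe0 mule1.
set An := tail_integral (fun s => phi s * F s ^+ n).
set An1 := tail_integral (fun s => phi s * F s ^+ n.+1).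
have An10 u : 0 <= An1 u by exact: tail_integral_ge0.
have mAn : measurable_fun setT An by exact: measurable_tail_integral.
have An0 u : 0 <= An u by exact: tail_integral_ge0.
rewrite expeS ih -/(An t) -/(An1 t) muleCA.
(* Multiplied by [n + 1], the right side becomes [(n + 2) * An1 t]. On the triangle [s > u] the
   inner integral of [phi s * F s ^+ n] is [An u], equal to [F u ^+ n.+1 / (n + 1)] by induction; on
   [u > s] the inner integral of [phi u] is [F s]. *)
suff -> : F t * An t = (n.+1%:R^-1)%:E * An1 t + An1 t.
  rewrite ge0_muleDr ?mule_ge0 ?lee_fin// muleA -EFinM divff// mul1e.
  by rewrite -[X in X + _]mul1e -ge0_muleDl ?lee_fin//.
pose K u s := (ppow 0 (u - t))%:E * phi u * ((ppow 0 (s - t))%:E * (phi s * F s ^+ n)).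
have K0 u s : 0 <= K u s by rewrite /K !mule_ge0.
have mK : measurable_fun setT (fun z : measurableTypeR R * measurableTypeR R => K z.1 z.2).
  have := mA n => mAn'.
  rewrite /K; apply: emeasurable_funM; first by meas.
  apply: emeasurable_funM; first by meas.
  by apply: (measurableT_comp (mA n)); exact: measurable_snd.
have mK1 u : measurable_fun setT (K u).
  have := mA n => mAn'.
  rewrite /K; apply: emeasurable_funM; first by meas.
  by apply: emeasurable_funM; [meas|exact: mA].
transitivity (\int[leb]_u \int[leb]_s K u s).
  rewrite FE /tail_integral -ge0_integralZr//; last 2 first.
  - by meas.
  - by move=> x _; rewrite mule_ge0.
  apply: eq_integral => u _; rewrite -ge0_integralZl//.
  - by apply: emeasurable_funM; [meas|exact: mA].
  - by move=> x _; rewrite !mule_ge0.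
  - by rewrite mule_ge0.
pose K1 u s := (ppow 0 (s - u))%:E * K u s.
pose K2 u s := (ppow 0 (u - s))%:E * K u s.
have mK1' : measurable_fun setT (fun z : measurableTypeR R * measurableTypeR R => K1 z.1 z.2).
  by rewrite /K1; apply: emeasurable_funM; [meas|exact: mK].
have mK2 : measurable_fun setT (fun z : measurableTypeR R * measurableTypeR R => K2 z.1 z.2).
  by rewrite /K2; apply: emeasurable_funM; [meas|exact: mK].
have K10 u s : 0 <= K1 u s by rewrite mule_ge0.
have K20 u s : 0 <= K2 u s by rewrite mule_ge0.
have mK1u u : measurable_fun setT (K1 u).
  by rewrite /K1; apply: emeasurable_funM; [meas|exact: mK1].
have mK2u u : measurable_fun setT (K2 u).
  by rewrite /K2; apply: emeasurable_funM; [meas|exact: mK1].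
transitivity (\int[leb]_u (\int[leb]_s K1 u s + \int[leb]_s K2 u s)).
  apply: eq_integral => u _; rewrite -ge0_integralD//; [|exact: mK1u|exact: mK2u].
  apply: (@ge0_ae_eq_integral _ _ _ leb setT (K u) (fun s => K1 u s + K2 u s) measurableT
    (mK1 u)); last 1 first.
  2: by apply: emeasurable_funD; [exact: mK1u|exact: mK2u].
  2: by move=> s _; exact: K0.
  2: by move=> s _; rewrite adde_ge0.
  (* For fixed [u] the diagonal is a single point, where both indicators vanish. *)
  exists [set u]; split; [exact: measurable_set1|exact: lebesgue_measure_set1|].
  move=> s /= /existsNP[_ H]; apply: contrapT => /eqP su; apply: H.
  rewrite /K1 /K2 -ge0_muleDl// -EFinD.
  have [us|us|us] := ltgtP u s.
  - by rewrite ppow_gt0E ?subr_gt0// powRr0 ppow_le0E ?subr_le0 ?ltW// addr0 mul1e.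
  - by rewrite ppow_le0E ?subr_le0 ?ltW// ppow_gt0E ?subr_gt0// powRr0 add0r mul1e.
  - by rewrite us eqxx in su.
rewrite ge0_integralD//; last 4 first.
- by move=> u _; apply: integral_ge0.
- exact: (@measurable_fun_fubini_tonelli_F _ _ _ _ R (@lebesgue_measure R) _ mK1' (fun z => K10 z.1 z.2)).
- by move=> u _; apply: integral_ge0.
- exact: (@measurable_fun_fubini_tonelli_F _ _ _ _ R (@lebesgue_measure R) _ mK2 (fun z => K20 z.1 z.2)).
congr (_ + _).
- have mA1 := mA n.+1.
  rewrite /An1 /tail_integral -ge0_integralZl//; last 2 first.
  - by apply: emeasurable_funM => //; meas.
  - by move=> s _; rewrite !mule_ge0.
  apply: eq_integral => u _; rewrite ih -/(An u).
  transitivity ((ppow 0 (u - t))%:E * phi u * An u); last first.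
    rewrite (muleCA (phi u)) (muleCA (ppow 0 (u - t))%:E) [RHS]muleA -EFinM mulVf//.
    by rewrite mul1e muleA.
  rewrite /An /tail_integral -ge0_integralZl//; last 3 first.
  - by apply: emeasurable_funM; [meas|exact: mA].
  - by move=> x _; rewrite !mule_ge0.
  - by rewrite mule_ge0.
  apply: eq_integral => s _; rewrite /K1 /K.
  have [ut|ut] := ltP 0%R (u - t)%R; last by rewrite (ppow_le0E _ ut) !mul0e mule0.
  have [us|us] := ltP 0%R (s - u)%R; last by rewrite (ppow_le0E _ us) !mul0e mule0.
  by rewrite !ppow_gt0E ?powRr0 ?mul1e//; lra.
have swapE : \int[leb]_u \int[leb]_s K2 u s = \int[leb]_s \int[leb]_u K2 u s.
  exact: (@fubini_tonelli _ _ _ _ R (@lebesgue_measure R) (@lebesgue_measure R) _ mK2 (fun z => K20 z.1 z.2)).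
rewrite swapE; clear swapE; apply: eq_integral => s _.
transitivity ((ppow 0 (s - t))%:E * (phi s * F s ^+ n) * F s); last first.
  by rewrite expeS !muleA (muleAC _ (F s)).
set c := (X in _ = X * _).
have c0 : 0 <= c by rewrite mule_ge0.
have cE : c = (ppow 0 (s - t))%:E * (phi s * F s ^+ n) by [].
clearbody c; clear ih An An1 An10 mAn An0; rewrite [X in _ * X]FE /tail_integral -ge0_integralZl//; last 2 first.
- by meas.
- by move=> x _; rewrite mule_ge0.
rewrite cE; apply: eq_integral => u _; rewrite /K2 /K.
have [st|st] := ltP 0%R (s - t)%R; last by rewrite (ppow_le0E _ st) !(mul0e, mule0).
have [us|us] := ltP 0%R (u - s)%R; last by rewrite (ppow_le0E _ us) !(mul0e, mule0).
by rewrite !ppow_gt0E ?powRr0 ?mul1e 1?muleC//; lra.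
Qed.

End Opaque.

Lemma tail_integral_pow n t : tail_integral phi t ^+ n.+1 =
  n.+1%:R%:E * tail_integral (fun s => phi s * tail_integral phi s ^+ n) t.
Proof. exact: (tail_integral_pow_eq (fun=> erefl)). Qed.

End TailPower.

(** * The past of the subordinator *)

Section Past.
Context (R : realType) (d : measure_display) (T : measurableType d)
  (P : probability T R) (alpha : R) (X : R -> T -> R).
Hypothesis SS : stable_subordinator P alpha X.

(** Starting at time 0, where the subordinator vanishes, makes each value [X (t i)] a sum of
    increments and hence measurable for the past. *)
Definition chain (k : nat) (t : nat -> R) :=
  t 0%N = 0 /\ forall i, (i < k)%N -> t i <= t i.+1.

Lemma chain_ge0 k t i : chain k t -> (i <= k)%N -> 0 <= t i.
Proof.
move=> [t0 tS]; elim: i => [|i ih] ik; first by rewrite t0.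
by rewrite (le_trans (ih (ltnW ik)))// tS.
Qed.

(** A finite sample of times suffices, since the moment induction adds one time per step. Such
    cylinders are stable under intersection, so independence can be checked on them. *)
Definition past_cylinders (k : nat) (t : nat -> R) : set (set T) :=
  [set A | exists B : nat -> set R, (forall i, measurable (B i)) /\
    A = \bigcap_(i in `I_k) (fun w => X (t i.+1) w - X (t i) w)%R @^-1` B i].

Definition past (k : nat) (t : nat -> R) := g_sigma_algebraType (past_cylinders k t).

Let mincr (a b : R) : measurable_fun setT (fun w => X b w - X a w).
Proof. by apply: measurable_funB; exact: subordinator_measurable SS _. Qed.

Lemma past_cylinders_measurable k t A : past_cylinders k t A -> measurable A.
Proof.
move=> [B [mB ->]]; apply: bigcap_measurableType => i _.
by rewrite -[X in measurable X]setTI; exact: mincr.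
Qed.

Lemma past_sub k t : <<s past_cylinders k t >> `<=` measurable.
Proof.
apply: smallest_sub; first exact: sigma_algebra_measurable.
exact: past_cylinders_measurable.
Qed.

Lemma past_cylinders_setI k t : setI_closed (past_cylinders k t).
Proof.
move=> _ _ [B [mB ->]] [C [mC ->]]; exists (fun i => B i `&` C i); split.
  by move=> i; exact: measurableI.
by rewrite -bigcapI.
Qed.

Definition extend (k : nat) (t : nat -> R) (s : R) (i : nat) : R :=
  if (i <= k)%N then t i else s.

Lemma chain_extend k t s : chain k t -> t k <= s -> chain k.+1 (extend k t s).
Proof.
move=> [t0 tS] ts; split=> [|i]; rewrite /extend ?leq0n// ltnS => ik; rewrite ik.
by move: ik; rewrite leq_eqVlt => /orP[/eqP->|ik]; rewrite ?ltnn// ik tS.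
Qed.

Let indep_cylinder k t (B : nat -> set R) : chain k t -> (forall i, measurable (B i)) ->
  P (\bigcap_(i in `I_k) (fun w => X (t i.+1) w - X (t i) w)%R @^-1` B i) =
  (\prod_(i < k) P ((fun w => X (t i.+1) w - X (t i) w)%R @^-1` B i))%E.
Proof.
move=> [t0 tS] mB; have [_ _ _ [ind _] _] := SS.
have t00 : 0 <= t 0%N by rewrite t0.
have [_ /(_ (fun i : 'I_k => B i) (fun i => mB i)) H] := ind k t t00 tS.
rewrite -H; congr (P _); apply/seteqP; split=> w /= Hw i /=.
  by move=> _; exact: (Hw i (ltn_ord i)).
by move=> ik; exact: (Hw (Ordinal ik) Logic.I).
Qed.

(** With the future event fixed, both sides are finite measures in [A]. They agree on cylinders, by
    mutual independence along the chain extended by [s], hence on the generated sigma-algebra. *)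
Lemma past_independent k t s (A : set T) (B : set R) : chain k t -> t k <= s ->
  <<s past_cylinders k t >> A -> measurable B ->
  P (A `&` (fun w => X s w - X (t k) w) @^-1` B) =
  (P A * P ((fun w => X s w - X (t k) w)%R @^-1` B))%E.
Proof.
move=> ct ts sA mB.
set S := (fun w => X s w - X (t k) w) @^-1` B.
have mS : measurable S by rewrite -[X in measurable X]setTI; exact: mincr.
have PS0 : 0 <= fine (P S) by rewrite fine_ge0.
have PSE : (fine (P S))%:E = P S by rewrite fineK// fin_num_measure.
have scaleE C : (mscale (NngNum PS0) P C = P C * P S)%E by rewrite /mscale/= PSE muleC.
have key C : past_cylinders k t C -> P (C `&` S) = mscale (NngNum PS0) P C.
  move=> [{}C [mC ->]]; rewrite scaleE.
  (* The increment of index [k], from [t k] to [s], is the one that receives [B]. *)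
  pose C' i := if (i < k)%N then C i else B.
  have mC' i : measurable (C' i) by rewrite /C'; case: ifP.
  have := indep_cylinder (chain_extend ct ts) mC'.
  rewrite big_ord_recr /= /extend /C' !ltnn leqnn => E.
  have -> : \bigcap_(i in `I_k) ((fun w => X (t i.+1) w - X (t i) w)%R @^-1` C i) `&` S =
     \bigcap_(i in `I_k.+1) ((fun w => X (if (i < k)%N then t i.+1 else s) w -
       X (if (i <= k)%N then t i else s) w) @^-1` (if (i < k)%N then C i else B)).
    apply/seteqP; split=> w.
      move=> [Hw Sw] i /=; rewrite ltnS => ik; rewrite ik; case: ifPn => [ik'|].
        exact: Hw.
      by rewrite -leqNgt => ki; have -> : i = k by apply/eqP; rewrite eqn_leq ik.
    move=> Hw; split.
      move=> i /= ik; have := Hw i; rewrite /= ltnS ik (ltnW ik); exact.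
    by have := Hw k; rewrite /= ltnS leqnn ltnn; exact.
  rewrite E; congr (_ * _)%E.
  rewrite indep_cylinder//; apply: eq_bigr => i _.
  by rewrite ltn_ord (ltnW (ltn_ord i)).
rewrite -scaleE.
apply: (@g_sigma_algebra_measure_unique _ R T (past_cylinders k t)
  (@past_cylinders_measurable k t) (fun=> setT) _ _ (mrestr P mS)
  (mscale (NngNum PS0) P) (@past_cylinders_setI k t)) => //.
- move=> _; exists (fun=> setT); split=> //.
  by apply/seteqP; split=> // w _ i.
- by apply: bigcup_const.
- move=> n; have H : (P (setT `&` S) < +oo)%E.
    by rewrite setTI (le_lt_trans (probability_le1 _ mS))// ltry.
  exact: H.
Qed.

Definition past_measurable k t (H : T -> \bar R) :=
  measurable_fun [set: past k t] (H : past k t -> \bar R).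

Lemma past_measurableW k t H : past_measurable k t H -> measurable_fun setT H.
Proof. by move=> mH _ B mB; apply: past_sub; exact: (mH measurableT B mB). Qed.

Lemma past_measurable_incr k t i : (i < k)%N ->
  measurable_fun [set: past k t] (fun w : past k t => X (t i.+1) w - X (t i) w).
Proof.
move=> ik _ B mB; rewrite setTI; apply: sub_sigma_algebra.
exists (fun j => if j == i then B else setT); split; first by move=> j; case: ifP.
apply/seteqP; split=> w /=; first by move=> H j /= _; case: ifP => // /eqP ->.
by move=> /(_ i ik); rewrite eqxx.
Qed.

Lemma past_measurable_X k t i : chain k t -> (i <= k)%N ->
  measurable_fun [set: past k t] (fun w : past k t => X (t i) w).
Proof.
move=> [t0 _]; elim: i => [|i ih] ik.
  rewrite t0 (_ : (fun w => _) = fun=> 0); first exact: measurable_cst.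
  by apply/funext => w; exact: subordinator0 SS w.
rewrite (_ : (fun w => _) = (fun w => (X (t i.+1) w - X (t i) w) + X (t i) w)).
  apply: measurable_funD; last exact: ih (ltnW ik).
  exact: past_measurable_incr.
by apply/funext => w; rewrite subrK.
Qed.

Lemma past_measurable_extend k t s H : past_measurable k t H ->
  past_measurable k.+1 (extend k t s) H.
Proof.
move=> mH _ B mB; have := mH measurableT B mB.
apply: sub_sigma_algebra2 => _ [C [mC ->]].
exists (fun j => if (j < k)%N then C j else setT); split.
  by move=> j; case: ifP.
apply/seteqP; split=> w Hw i /=; rewrite /extend.
  by move=> _; case: ifP => // ik; have := Hw i ik; rewrite /= (ltnW ik).
by move=> ik; have := Hw i; rewrite /= /extend ltnS ik (ltnW ik); apply.
Qed.

(** The past and the next increment are independent, so their joint law is a product. Tonelli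
    integrates the increment first, and stationarity replaces it by [X (s - t k)]. *)
Lemma past_markov k t s (H : T -> \bar R) (f : R -> \bar R) : chain k t -> t k <= s ->
  past_measurable k t H -> (forall w, 0 <= H w)%E ->
  measurable_fun setT f -> (forall x, 0 <= f x)%E ->
  (\int[P]_w (H w * f (X s w)) =
   \int[P]_w (H w * \int[P]_v f (X (t k) w + X (s - t k) v)%R))%E.
Proof.
move=> ct ts mH H0 mf f0; have [_ _ _ [_ stat] _] := SS.
have tk0 : 0 <= t k by exact: chain_ge0 ct (leqnn k).
pose Y w := X s w - X (t k) w.
have mY : measurable_fun setT Y by exact: mincr.
have mXs : measurable_fun setT (X (s - t k)) by exact: subordinator_measurable SS _.
(* The identity, seen as a random variable into [T] with the smaller sigma-algebra: its law is [P]
   restricted to the past, which turns independence of the past into a product law. *)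
have mid : measurable_fun setT (fun w : T => w : past k t).
  by move=> _ B mB; rewrite setTI; exact: (past_sub mB).
have mpair : measurable_fun setT (fun w : T => ((w : past k t), (Y w : R))).
  exact: measurable_fun_pair.
pose idm : {mfun T >-> past k t} :=
  HB.pack (fun w : T => w : past k t) (isMeasurableFun.Build _ _ _ _ _ mid).
pose Xm : {mfun T >-> R} :=
  HB.pack (X (s - t k)) (isMeasurableFun.Build _ _ _ _ _ mXs).
pose pm : {mfun T >-> (past k t * R)%type} :=
  HB.pack (fun w : T => ((w : past k t), (Y w : R)))
    (isMeasurableFun.Build _ _ _ _ _ mpair).
pose P1 := distribution P idm; pose P2 := distribution P Xm.
have prodE A : measurable A -> (P1 \x P2)%E A = distribution P pm A.
  apply: product_measure_unique => {}A B mA mB.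
  have := past_independent ct ts mA mB; rewrite -/Y => E.
  transitivity (P (A `&` Y @^-1` B)) => //; rewrite E; congr (_ * _)%E.
  transitivity (P [set w | X s w - X (t k) w \in B]).
    by congr (P _); apply/seteqP; split=> w /=; rewrite inE.
  rewrite stat//; transitivity (P (X (s - t k) @^-1` B)) => //.
  by congr (P _); apply/seteqP; split=> w /=; rewrite inE.
pose F (z : past k t * R) := (H z.1 * f (X (t k) z.1 + z.2)%R)%E.
have mH1 : measurable_fun setT (fun z : past k t * R => H z.1).
  exact: (measurableT_comp (f := H : past k t -> \bar R) mH measurable_fst).
have mX1 : measurable_fun setT (fun z : past k t * R => X (t k) z.1).
  exact: (measurableT_comp (f := X (t k) : past k t -> R)
    (past_measurable_X ct (leqnn k)) measurable_fst).
have mF : measurable_fun setT F.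
  apply: emeasurable_funM; first exact: mH1.
  apply: (measurableT_comp mf); apply: measurable_funD; first exact: mX1.
  exact: measurable_snd.
have F0 z : (0 <= F z)%E by rewrite mule_ge0.
transitivity (\int[distribution P pm]_z F z)%E.
  rewrite ge0_integral_distribution//; apply: eq_integral => w _.
  by rewrite /F /= /Y addrC subrK.
transitivity (\int[P1 \x P2]_z F z)%E.
  by apply: eq_measure_integral => A mA _; apply/esym; exact: prodE.
rewrite (@fubini_tonelli1 _ _ _ _ R P1 P2 F mF F0).
have mFF := @measurable_fun_fubini_tonelli_F _ _ _ _ R P2 F mF F0.
have FF0 w : (0 <= fubini_F P2 F w)%E by apply: integral_ge0.
rewrite (ge0_integral_distribution idm mFF FF0).
apply: eq_integral => w _; rewrite /= /fubini_F /F /=.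
have mfw : measurable_fun setT (fun x : R => f (X (t k) w + x)).
  by apply: (measurableT_comp mf); apply: measurable_funD.
rewrite ge0_integralZl//; congr (_ * _)%E.
by rewrite ge0_integral_distribution.
Qed.

End Past.

(** * Moments *)

Section Moments.
Context (R : realType) (d : measure_display) (T : measurableType d)
  (P : probability T R) (alpha gamma : R) (X : R -> T -> R).
Hypotheses (alpha0 : 0 < alpha) (alpha1 : alpha < 1) (theta0 : 0 < alpha + gamma).
Hypothesis SS : stable_subordinator P alpha X.
Let leb := @lebesgue_measure R.
Let theta := alpha + gamma.
Let phi (x : R) : R := ppow gamma (1 - x).

Let phi_ge0 x : (0 <= (phi x)%:E)%E. Proof. by rewrite lee_fin ppow_ge0. Qed.

Let mphi : measurable_fun setT phi.
Proof. by have := @measurable_ppow R gamma => mp; rewrite /phi; meas. Qed.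

Let mX : measurable_fun setT (fun z : measurableTypeR R * T => Xpos X z.1 z.2).
Proof. exact: measurable_Xpos SS. Qed.

Let mXs s : measurable_fun setT (X s).
Proof. exact: subordinator_measurable SS s. Qed.

Definition tail (w : T) : R -> \bar R := tail_integral (fun s => (phi (Xpos X s w))%:E).

Let mphiX w : measurable_fun setT (fun s => (phi (Xpos X s w))%:E).
Proof.
apply/measurable_EFinP; apply: (measurableT_comp mphi).
exact: (measurable_fun_pair1 w mX).
Qed.

Lemma tail_ge0 w s : (0 <= tail w s)%E.
Proof. exact: tail_integral_ge0. Qed.

Lemma measurable_tail :
  measurable_fun setT (fun z : measurableTypeR R * T => tail z.2 z.1).
Proof.
have mp := @measurable_ppow R 0.
pose F (z : (measurableTypeR R * T) * measurableTypeR R) :=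
  ((ppow 0 (z.2 - z.1.1))%:E * (phi (Xpos X z.2 z.1.2))%:E)%E.
have mF : measurable_fun setT F.
  apply: emeasurable_funM; first by meas.
  apply/measurable_EFinP; apply: (measurableT_comp mphi).
  apply: (@measurableT_comp _ _ _ _ _ _ (fun z : measurableTypeR R * T => Xpos X z.1 z.2)
    setT (fun z : (measurableTypeR R * T) * measurableTypeR R => (z.2, z.1.2)) mX).
  by apply: measurable_fun_pair; meas.
have F0 z : (0 <= F z)%E by rewrite mule_ge0 ?lee_fin ?ppow_ge0.
exact: (@measurable_fun_fubini_tonelli_F _ _ _ _ R (@lebesgue_measure R) F mF F0).
Qed.

Let mtailn n : measurable_fun setT (fun z : measurableTypeR R * T => (tail z.2 z.1 ^+ n)%E).
Proof.
elim: n => [|n ih]; first by under eq_fun do rewrite expe0; exact: measurable_cst.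
under eq_fun do rewrite expeS.
by apply: emeasurable_funM; [exact: measurable_tail|exact: ih].
Qed.

Let f n (x : R) : \bar R := (ppow (n%:R * theta + gamma) (1 - x))%:E.
Let mf n : measurable_fun setT (f n).
Proof. by have := @measurable_ppow R (n%:R * theta + gamma) => mp; rewrite /f; meas. Qed.
Let f0 n x : (0 <= f n x)%E. Proof. by rewrite lee_fin ppow_ge0. Qed.

Let b n := n%:R * theta + gamma + 1.
Let b_gt0 n : 0 < b n.
Proof.
have : 0 <= n%:R * theta by rewrite mulr_ge0// ltW.
rewrite /b /theta; move: theta0 alpha1; lra.
Qed.

Lemma c_coefS n : c_coef alpha gamma n.+1 =
  c_coef alpha gamma n * (Gamma (b n) / Gamma (alpha + b n)).
Proof.
have -> : alpha + b n = n.+1%:R * (alpha + gamma) + 1.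
  by rewrite /b /theta -natr1; ring.
by rewrite /c_coef big_nat_recr.
Qed.

Lemma c_coef_gt0 n : 0 < c_coef alpha gamma n.
Proof.
elim: n => [|n ih]; first by rewrite /c_coef big_nil.
by rewrite c_coefS mulr_gt0// divr_gt0// Gamma_gt0// addr_gt0.
Qed.

(* The Beta convolution turns the potential of a power into a power: this is the
   recursion behind the moments. *)
Let potential_f n a :
  (\int[leb]_r ((ppow 0 r)%:E * \int[P]_v f n (a + Xpos X r v)) =
   (Gamma (b n) / Gamma (alpha + b n) * ppow (n.+1%:R * theta) (1 - a))%:E)%E.
Proof.
have mfa : measurable_fun setT (fun x : R => f n (a + x)).
  by apply: (measurableT_comp (mf n)); exact: measurable_funD.
rewrite (subordinator_potential alpha0 SS mfa (fun=> f0 n _)).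
have mpa := @measurable_ppow R (alpha - 1).
have mpb := @measurable_ppow R (b n - 1).
have G0 := Gamma_gt0 alpha0.
transitivity (\int[leb]_x ((Gamma alpha)^-1%:E *
  (ppow (alpha - 1) x * ppow (b n - 1) ((1 - a) - x))%:E))%E.
  apply: eq_integral => x _; rewrite /f -!EFinM; congr EFin.
  rewrite (_ : b n - 1 = n%:R * theta + gamma); last by rewrite /b; ring.
  rewrite (_ : 1 - (a + x) = 1 - a - x); last by ring.
  by ring.
rewrite ge0_integralZl//; last 3 first.
- by meas.
- by move=> x _; rewrite lee_fin mulr_ge0 ?ppow_ge0.
- by rewrite lee_fin invr_ge0 ltW.
rewrite Beta_convolution// -EFinM; congr EFin.
rewrite (_ : alpha + b n - 1 = n.+1%:R * theta); last by rewrite /b -natr1 /theta; ring.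
by rewrite !mulrA mulVf ?mul1r// gt_eqF.
Qed.


Let HphiE n k (t : nat -> R) (H : T -> \bar R) w :
  (H w * (phi (X (t k) w))%:E * (ppow (n%:R * theta) (1 - X (t k) w))%:E =
   H w * f n (X (t k) w))%E.
Proof. by rewrite -muleA -EFinM /phi ppowD addrC. Qed.

(** A conditional moment formula under the weight [phi]: given the past up to [t k], the [n]-th
    moment of the tail is [n! c_n] times the positive part of [1 - X (t k)] to the power [n theta].
    The test function [H] lets the induction absorb each treated time into the past. The factor
    [phi] is what a new time brings; it raises the exponent [n theta] to that of [f n], and
    [potential_f] raises this to [(n + 1) theta]. *)
Lemma tail_moments n k (t : nat -> R) (H : T -> \bar R) : chain k t ->
  past_measurable X k t H -> (forall w, 0 <= H w)%E ->
  (\int[P]_w (H w * (phi (X (t k) w))%:E * tail w (t k) ^+ n) =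
   (n`!%:R * c_coef alpha gamma n)%:E *
     \int[P]_w (H w * (phi (X (t k) w))%:E *
                (ppow (n%:R * theta) (1 - X (t k) w))%:E))%E.
Proof.
elim: n k t H => [|n ih] k t H ct pH H0.
  (* The remaining [ppow 0] is an indicator, absorbed by [phi], which vanishes on the same set. *)
  rewrite /c_coef big_nil mulr1 mul1e; apply: eq_integral => w _.
  rewrite expe0 mule1 mul0r -muleA -EFinM /phi ppowD addr0.
  by [].
have [c cE] : exists c, c = (n`!%:R * c_coef alpha gamma n)%:E by eexists.
have c0 : (0 <= c)%E by rewrite cE lee_fin mulr_ge0// ltW// c_coef_gt0.
rewrite -cE in ih.
set s0 := t k; have s00 : 0 <= s0 by exact: chain_ge0 ct (leqnn k).
pose H' w : \bar R := (H w * (phi (X s0 w))%:E)%E.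
have H'0 w : (0 <= H' w)%E by rewrite mule_ge0.
have pH' : past_measurable X k t H'.
  apply: emeasurable_funM; first exact: pH.
  have mXp := past_measurable_X SS ct (leqnn k).
  by apply/measurable_EFinP; exact: (measurableT_comp mphi mXp).
have mH' : measurable_fun setT H' by exact: (past_measurableW SS pH').
have mp := @measurable_ppow R 0.
have tailE w : (tail w s0 ^+ n.+1 = n.+1%:R%:E *
    \int[leb]_s ((ppow 0 (s - s0))%:E * ((phi (Xpos X s w))%:E * tail w s ^+ n)))%E.
  exact: (tail_integral_pow (mphiX w) (fun s => phi_ge0 _)).
pose K s w := ((ppow 0 (s - s0))%:E * (H' w * ((phi (Xpos X s w))%:E * tail w s ^+ n)))%E.
pose J s w := (\int[P]_v f n (X s0 w + Xpos X (s - s0) v))%E.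
pose L s w := ((ppow 0 (s - s0))%:E * (H' w * J s w))%E.
have J0 s w : (0 <= J s w)%E by apply: integral_ge0.
have p0 s : (0 <= (ppow 0 (s - s0))%:E)%E by rewrite lee_fin ppow_ge0.
have K0 s w : (0 <= K s w)%E.
  by rewrite !mule_ge0// expe_ge0// tail_ge0.
have L0 s w : (0 <= L s w)%E by rewrite !mule_ge0.
have mp1 : measurable_fun setT (fun z : measurableTypeR R * T => (ppow 0 (z.1 - s0))%:E).
  by meas.
have mH1 : measurable_fun setT (fun z : measurableTypeR R * T => H' z.2).
  by apply: (measurableT_comp mH'); exact: measurable_snd.
have mphiX2 : measurable_fun setT (fun z : measurableTypeR R * T => (phi (Xpos X z.1 z.2))%:E).
  by apply/measurable_EFinP; exact: (measurableT_comp mphi mX).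
have mphitail : measurable_fun setT
    (fun z : measurableTypeR R * T => ((phi (Xpos X z.1 z.2))%:E * tail z.2 z.1 ^+ n)%E).
  by apply: emeasurable_funM; [exact: mphiX2|exact: mtailn].
have mK : measurable_fun setT (fun z : measurableTypeR R * T => K z.1 z.2).
  by apply: emeasurable_funM; [exact: mp1|apply: emeasurable_funM; [exact: mH1|]].
have mJ : measurable_fun setT (fun z : measurableTypeR R * T => J z.1 z.2).
  pose F (z : (measurableTypeR R * T) * T) := f n (X s0 z.1.2 + Xpos X (z.1.1 - s0) z.2).
  have mF : measurable_fun setT F.
    apply: (measurableT_comp (mf n)); apply: measurable_funD.
      by apply: (measurableT_comp (mXs s0)); meas.
    apply: (@measurableT_comp _ _ _ _ _ _ (fun z : measurableTypeR R * T => Xpos X z.1 z.2)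
      setT (fun z : (measurableTypeR R * T) * T => (z.1.1 - s0, z.2)) mX).
    by apply: measurable_fun_pair; meas.
  exact: (@measurable_fun_fubini_tonelli_F _ _ _ _ R P F mF (fun=> f0 n _)).
have mL : measurable_fun setT (fun z : measurableTypeR R * T => L z.1 z.2).
  by apply: emeasurable_funM; [exact: mp1|apply: emeasurable_funM; [exact: mH1|]].
have swapK : (\int[P]_w \int[leb]_s K s w = \int[leb]_s \int[P]_w K s w)%E.
  apply/esym; exact: (@fubini_tonelli _ _ _ _ R (@lebesgue_measure R) P _ mK (fun z => K0 z.1 z.2)).
have swapL : (\int[P]_w \int[leb]_s L s w = \int[leb]_s \int[P]_w L s w)%E.
  apply/esym; exact: (@fubini_tonelli _ _ _ _ R (@lebesgue_measure R) P _ mL (fun z => L0 z.1 z.2)).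
(* At a fixed [s > s0] the induction hypothesis is applied to the chain extended by [s] with test
   function [H'], and the Markov property then conditions at [s0]. For [s <= s0] the indicator kills
   both sides. *)
have KL s : (\int[P]_w K s w = c * \int[P]_w L s w)%E.
  have [s1|s1] := ltP s0 s; last first.
    have pz : ppow 0 (s - s0) = 0 by rewrite ppow_le0E// subr_le0.
    rewrite /K /L pz; under eq_integral do rewrite mul0e.
    under [in RHS]eq_integral do rewrite mul0e.
    by rewrite !integral0 mule0.
  have ce := chain_extend ct (ltW s1).
  have := ih k.+1 (extend k t s) H' ce (past_measurable_extend pH' (s := s)) H'0.
  have es : extend k t s k.+1 = s by rewrite /extend ltnn.
  rewrite es => E.
  have p1 : ppow 0 (s - s0) = 1 by rewrite ppow_gt0E ?subr_gt0// powRr0.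
  have s10 : 0 <= s by rewrite (le_trans s00)// ltW.
  transitivity (\int[P]_w (H' w * (phi (X s w))%:E * tail w s ^+ n))%E.
    by apply: eq_integral => w _; rewrite /K p1 mul1e XposE// muleA.
  have E2 : (\int[P]_w (H' w * f n (X s w)) = \int[P]_w L s w)%E.
    rewrite (past_markov SS ct (ltW s1) pH' H'0 (mf n) (f0 n)).
    apply: eq_integral => w _; rewrite /L p1 mul1e /J.
    rewrite (eq_integral (fun v => f n (X s0 w + Xpos X (s - s0) v)))// => v _.
    by rewrite XposE// subr_ge0 ltW.
  have E1 : (\int[P]_w (H' w * (phi (X s w))%:E * (ppow (n%:R * theta) (1 - X s w))%:E) =
      \int[P]_w (H' w * f n (X s w)))%E.
    by apply: eq_integral => w _; rewrite -es HphiE.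
  rewrite E E1 E2; reflexivity.
clear ih.
have step1 : (\int[P]_w (H' w * tail w s0 ^+ n.+1) =
    n.+1%:R%:E * \int[P]_w \int[leb]_s K s w)%E.
  rewrite -ge0_integralZl//; last 2 first.
  - exact: (@measurable_fun_fubini_tonelli_G _ _ _ _ R (@lebesgue_measure R) _ mK (fun z => K0 z.1 z.2)).
  - by move=> w _; apply: integral_ge0.
  apply: eq_integral => w _; rewrite tailE muleCA; congr (_ * _)%E.
  rewrite -ge0_integralZl//; last 2 first.
  - apply: emeasurable_funM; first by meas.
    exact: (measurable_fun_pair1 w mphitail).
  - by move=> s _; rewrite !mule_ge0// expe_ge0// tail_ge0.
  by apply: eq_integral => s _; rewrite /K muleCA.
have step2 : (\int[leb]_s \int[P]_w K s w =
    c * \int[leb]_s \int[P]_w L s w)%E.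
  rewrite -ge0_integralZl//; last 2 first.
  - exact: (@measurable_fun_fubini_tonelli_F _ _ _ _ R P _ mL (fun z => L0 z.1 z.2)).
  - by move=> w _; apply: integral_ge0.
  by apply: eq_integral => s _; rewrite KL.
have inner w : (\int[leb]_s L s w = H' w *
    (Gamma (b n) / Gamma (alpha + b n) * ppow (n.+1%:R * theta) (1 - X s0 w))%:E)%E.
  rewrite -potential_f.
  have mG : measurable_fun setT (fun s : R => (ppow 0 (s - s0))%:E * J s w)%E.
    by apply: emeasurable_funM; [meas|exact: (measurable_fun_pair1 w mJ)].
  have G0 s : (0 <= (ppow 0 (s - s0))%:E * J s w)%E by rewrite mule_ge0.
  transitivity (H' w * \int[leb]_s ((ppow 0 (s - s0))%:E * J s w))%E.
    rewrite -(ge0_integralZl (@lebesgue_measure R) measurableT mG (fun s _ => G0 s) (H'0 w)).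
    by apply: eq_integral => s _; rewrite /L muleCA.
  apply: (congr1 (mule (H' w))).
  apply: (etrans (esym (@integral_affine _ 1 s0 _ (oner_neq0 _) mG G0))).
  by apply: eq_integral => r _; rewrite normr1 mul1e mul1r /J addrK.
rewrite step1 swapK step2 -swapL muleA.
under eq_integral do rewrite inner.
have Gc : 0 <= Gamma (b n) / Gamma (alpha + b n).
  by rewrite divr_ge0// ltW// Gamma_gt0// addr_gt0.
have mpn := @measurable_ppow R (n.+1%:R * theta).
transitivity (n.+1%:R%:E * c *
   ((Gamma (b n) / Gamma (alpha + b n))%:E *
   \int[P]_w (H' w * (ppow (n.+1%:R * theta) (1 - X s0 w))%:E)))%E.
  rewrite -[in RHS]ge0_integralZl//.
  - rewrite [X in (_ * X)%E](_ : _ = \int[P]_w ((Gamma (b n) / Gamma (alpha + b n))%:E *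
      (H' w * (ppow (n.+1%:R * theta) (1 - X s0 w))%:E)))%E; first by reflexivity.
    by apply: eq_integral => w _; rewrite EFinM muleCA.
  - apply: emeasurable_funM; first exact: mH'.
    apply/measurable_EFinP; apply: (measurableT_comp mpn).
    by apply: measurable_funB => //; exact: mXs.
  - by move=> w _; rewrite mule_ge0// lee_fin ppow_ge0.
rewrite muleA cE -!EFinM.
have -> : n.+1%:R * (n`!%:R * c_coef alpha gamma n) * (Gamma (b n) / Gamma (alpha + b n)) =
    (n.+1)`!%:R * c_coef alpha gamma n.+1.
  by rewrite factS natrM c_coefS; ring.
by [].
Qed.

End Moments.

Section ZMoments.
Context (R : realType) (d : measure_display) (T : measurableType d)
  (P : probability T R) (alpha gamma : R) (X : R -> T -> R).
Hypotheses (alpha0 : 0 < alpha) (alpha1 : alpha < 1) (theta0 : 0 < alpha + gamma).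
Hypothesis SS : stable_subordinator P alpha X.
Let leb := @lebesgue_measure R.

Lemma Zag_tail w : Zag gamma X w = tail gamma X w 0.
Proof.
have mphi : measurable_fun setT (fun s => (ppow gamma (1 - Xpos X s w))%:E).
  have mX := measurable_fun_pair1 w (measurable_Xpos SS).
  have := @measurable_ppow R gamma => mp; apply/measurable_EFinP.
  apply: (measurableT_comp mp); apply: measurable_funB => //.
rewrite /Zag /tail /tail_integral.
transitivity (\int[leb]_(s in `[0%R, +oo[%classic) (ppow gamma (1 - Xpos X s w))%:E)%E.
  apply: eq_integral => s; rewrite inE/= in_itv/= andbT => s0.
  by rewrite XposE// /ppow subr_gt0.
rewrite -integral_itv_obnd_cbnd; last exact: measurable_funTS.
transitivity (\int[leb]_(s in `]0%R, +oo[) ((s `^ 0)%:E * (ppow gamma (1 - Xpos X s w))%:E))%E.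
  by apply: eq_integral => s _; rewrite powRr0 mul1e.
rewrite ppow_restrict.
by apply: eq_integral => s _; rewrite subr0.
Qed.

Lemma Zag_ge0 w : (0 <= Zag gamma X w)%E.
Proof. by rewrite Zag_tail; exact: tail_ge0. Qed.

Lemma measurable_Zag : measurable_fun setT (Zag gamma X).
Proof.
rewrite (_ : Zag gamma X = fun w => tail gamma X w 0); last exact/funext/Zag_tail.
exact: (@measurable_fun_pair2 _ _ _ (measurableTypeR R) T _ _ 0 (measurable_tail gamma SS)).
Qed.

(** The chain reduced to time 0: there [X] vanishes, so [phi] and the power on the right are both
    1. *)
Lemma Zag_moments n :
  (\int[P]_w (Zag gamma X w ^+ n) = (n`!%:R * c_coef alpha gamma n)%:E)%E.
Proof.
have ch : chain 0 (fun=> 0 : R) by split.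
have ph : past_measurable X 0 (fun=> 0) (fun=> 1%E : \bar R) by exact: measurable_cst.
have M := tail_moments alpha0 alpha1 theta0 SS n ch ph (fun=> lee01).
have X0 w : X 0 w = 0 by exact: subordinator0 SS w.
have p1 r : ppow r (1 - 0) = 1 :> R by rewrite subr0 ppow_gt0E// powR1.
transitivity (\int[P]_w (1 * (ppow gamma (1 - X 0 w))%:E * tail gamma X w 0 ^+ n))%E.
  by apply: eq_integral => w _; rewrite X0 p1 !mul1e Zag_tail.
rewrite M [X in (_ * X)%E](_ : _ = \int[P]_w (cst 1 w))%E; last first.
  by apply: eq_integral => w _; rewrite X0 !p1 !mul1e.
have PT : P setT = 1%E by exact: probability_setT.
by rewrite integral_cst// mul1e [X in (_ * X)%E]PT mule1.
Qed.

(** On every path, right-continuity at 0 keeps [X] below 1 on an interval of positive length. If [Z]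
    were 0, the set defining [Aag] would be empty. *)
Lemma Zag_gt0 w : (0 < Zag gamma X w)%E.
Proof.
have [_ nd rc _ _] := SS.
have : (fun u => X u w) @ at_right 0 --> (0 : R).
  by rewrite -[X in _ --> X](subordinator0 SS w); exact: rc.
move=> /cvgr_lt /(_ 1 ltr01) [e /= e0 He].
have lt1 s : 0 <= s -> s < e -> X s w < 1.
  rewrite le_eqVlt => /orP[/eqP <- _|s0 se]; first by rewrite (subordinator0 SS).
  by apply: He => //=; rewrite sub0r normrN gtr0_norm.
have mX := measurable_fun_pair1 w (measurable_Xpos SS).
have mp := @measurable_ppow R gamma; have mp0 := @measurable_ppow R 0.
have mphi : measurable_fun setT (fun s => (ppow gamma (1 - Xpos X s w))%:E).
  apply/measurable_EFinP; apply: (measurableT_comp mp).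
  by apply: measurable_funB => //.
rewrite Zag_tail /tail /tail_integral.
apply: (@integral_gt0 _ _ _ leb setT `]0%R, e[%classic) => //.
- by apply: emeasurable_funM => //; meas.
- by move=> s _; rewrite mule_ge0// lee_fin ppow_ge0.
- move=> s /=; rewrite in_itv/= => /andP[s0 se].
  rewrite -EFinM lte_fin mulr_gt0 ?ppow_gt0E ?subr0// ?powR_gt0//.
    by rewrite XposE ?(ltW s0)// subr_gt0 lt1// ltW.
  by rewrite XposE ?(ltW s0)// subr_gt0 lt1// ltW.
- by rewrite [ltRHS]lebesgue_measure_itv/= lte_fin e0 sube0 lte_fin.
Qed.

Lemma Zag_fin : {ae P, forall w, Zag gamma X w \is a fin_num}.
Proof.
have H := Zag_moments 1.
apply: (@filterS _ _ _ (fun w => setT w -> Zag gamma X w \is a fin_num)) => [w|]; first exact.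
apply: integrable_ae => //; apply/integrableP; split; first exact: measurable_Zag.
under eq_integral do rewrite gee0_abs ?Zag_ge0//.
by rewrite H ltry.
Qed.

End ZMoments.

(** * Power series with rapidly decreasing coefficients *)

Section FastDecay.
Context {R : realType}.
Implicit Types a : nat -> R.

(** This says that the radius of convergence is infinite. The form is closed under [pseries_diffs],
    and termwise differentiation calls for convergence of the series and of its first two formal
    derivatives. *)
Definition fast_decay a := forall r : R, 0 < r -> exists M, forall n, `|a n| <= M * r ^+ n.

Lemma fast_decay_ratio a : (forall n, 0 < a n) ->
  a n.+1 / a n @[n --> \oo] --> (0 : R) -> fast_decay a.
Proof.
move=> a0 /cvgr_lt ratio r r0; have [N _ HN] := ratio r r0.
have step n : (N <= n)%N -> a n.+1 <= r * a n.
  by move=> /HN /=; rewrite ltr_pdivrMr// => /ltW.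
have tail k : a (N + k)%N <= a N * r ^+ k.
  elim: k => [|k ih]; first by rewrite addn0 expr0 mulr1.
  rewrite addnS exprS (le_trans (step _ (leq_addr _ _)))// mulrCA ler_pM2l//.
(* The sum dominates each initial ratio [a i / r ^+ i], and from [N] on these ratios decrease. *)
exists (\sum_(i < N.+1) a i / r ^+ i) => n; rewrite (ger0_norm (ltW (a0 n))).
have term_ge0 (i : 'I_N.+1) : true -> 0 <= a i / r ^+ i.
  by move=> _; rewrite divr_ge0 ?exprn_ge0 ?ltW.
have le_sum i : (i < N.+1)%N -> a i / r ^+ i <= \sum_(i < N.+1) a i / r ^+ i.
  move=> iN; rewrite (bigD1 (Ordinal iN))//= lerDl sumr_ge0// => j _.
  exact: term_ge0.
rewrite -ler_pdivrMr ?exprn_gt0//.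
have [nN|Nn] := ltnP n N.+1; first exact: le_sum.
apply: le_trans (le_sum N (ltnSn N)).
have := tail (n - N)%N; rewrite subnKC ?(ltnW Nn)// => H.
rewrite ler_pdivrMr ?exprn_gt0// (le_trans H)//.
by rewrite -[in r ^+ n](subnKC (ltnW Nn)) exprD mulrA divfK// expf_neq0// gt_eqF.
Qed.

Lemma fast_decay_diffs a : fast_decay a -> fast_decay (pseries_diffs a).
Proof.
(* Decay at rate [r / 2] leaves a factor [2 ^ (n + 1)] to absorb the [n + 1] of the derivative. *)
move=> da r r0; have r20 : 0 < r / 2 by rewrite divr_gt0.
have [M HM] := da _ r20; exists (M * r) => n.
have M0 : 0 <= M by have := le_trans (normr_ge0 _) (HM 0%N); rewrite expr0 mulr1.
rewrite /pseries_diffs normrM normr_nat.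
apply: (le_trans (ler_wpM2l _ (HM n.+1))) => //.
rewrite mulrCA -mulrA -exprS ler_wpM2l//.
have -> : r ^+ n.+1 = 2 ^+ n.+1 * (r / 2) ^+ n.+1 by rewrite -exprMn mulrC divfK.
by rewrite ler_wpM2r ?exprn_ge0 ?(ltW r20)// -natrX ler_nat ltnW// ltn_expl.
Qed.

Lemma fast_decay_cvg a x : fast_decay a -> cvgn (pseries a x).
Proof.
move=> da; have x0 : 0 < `|x| + 1 by rewrite ltr_wpDl.
(* With this rate the terms at [x] are at most [M / 2 ^ n]; the added 1 keeps the rate meaningful at
   [x = 0]. *)
have r0 : 0 < 2^-1 / (`|x| + 1) :> R by rewrite divr_gt0 ?invr_gt0.
have [M HM] := da _ r0.
have M0 : 0 <= M by have := le_trans (normr_ge0 _) (HM 0%N); rewrite expr0 mulr1.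
apply: normed_cvg; apply: (@series_le_cvg _ _ (geometric M 2^-1)).
- by move=> n /=; exact: normr_ge0.
- by move=> n; rewrite /geometric/= mulr_ge0// exprn_ge0// invr_ge0.
- move=> n; rewrite /geometric/= normrM normrX.
  apply: (@le_trans _ _ (M * (2^-1 / (`|x| + 1)) ^+ n * (`|x| + 1) ^+ n)).
    by rewrite ler_pM ?exprn_ge0// lerXn2r ?nnegrE ?(ltW x0)// lerDl.
  by rewrite -mulrA -exprMn divfK// gt_eqF.
- by apply: is_cvg_geometric_series; rewrite ger0_norm ?invr_ge0// invf_lt1// ltr1n.
Qed.

Lemma fast_decay_derive a (x : R) : fast_decay a ->
  is_derive x 1 (fun x => limn (pseries a x)) (limn (pseries (pseries_diffs a) x)).
Proof.
move=> da; apply: (@pseries_snd_diffs _ _ (`|x| + 1)).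
- exact: fast_decay_cvg.
- exact/fast_decay_cvg/fast_decay_diffs.
- exact/fast_decay_cvg/fast_decay_diffs/fast_decay_diffs.
- by rewrite [ltRHS]ger0_norm ?addr_ge0// ltrDl.
Qed.

End FastDecay.

(** * The density *)

Section Density.
Context (R : realType) (d : measure_display) (T : measurableType d)
  (P : probability T R) (alpha gamma : R) (X : R -> T -> R).
Hypotheses (alpha0 : 0 < alpha) (alpha1 : alpha < 1) (theta0 : 0 < alpha + gamma).
Let leb := @lebesgue_measure R.
Let theta := alpha + gamma.
Let c := c_coef alpha gamma.
Let b (n : nat) := n%:R * theta + gamma + 1.

Let b_gt0 n : 0 < b n.
Proof.
have : 0 <= n%:R * theta by rewrite mulr_ge0// ltW.
rewrite /b /theta; move: theta0 alpha1; lra.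
Qed.

(** Up to the constant [Gamma alpha], the ratio of consecutive coefficients is the Beta integral of
    [b n] and [alpha]. Its integrand tends to 0 pointwise as the exponent of [x] grows, so dominated
    convergence replaces asymptotics of [Gamma]. *)
Lemma c_coef_fast_decay : fast_decay c.
Proof.
apply: fast_decay_ratio; first by move=> n; exact: c_coef_gt0.
have ratioE n : c n.+1 / c n = Gamma (b n) * Gamma alpha / Gamma (b n + alpha) * (Gamma alpha)^-1.
  have c0 := c_coef_gt0 alpha0 alpha1 theta0 n.
  have G0 := Gamma_gt0 alpha0.
  have G1 : 0 < Gamma (alpha + b n) by rewrite Gamma_gt0// addr_gt0.
  rewrite /c c_coefS (addrC (b n)) -/(b n).
  move: c0 G0 G1; move: (c_coef _ _ n) (Gamma (b n)) (Gamma alpha) (Gamma (alpha + b n)).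
  by move=> x y z u x0 z0 u0; field; rewrite (gt_eqF x0) (gt_eqF z0) (gt_eqF u0).
suff L : Gamma (b n) * Gamma alpha / Gamma (b n + alpha) * (Gamma alpha)^-1 @[n --> \oo] -->
    0 * (Gamma alpha)^-1 by rewrite mul0r in L; under eq_cvg do rewrite ratioE.
apply: cvgM; last exact: cvg_cst.
pose f n (x : R) : \bar R := (ppow (b n - 1) x * ppow (alpha - 1) (1 - x))%:E.
have mp := @measurable_ppow R.
have mf n : measurable_fun setT (f n).
  by rewrite /f; have := mp (b n - 1) => mb; have := mp (alpha - 1) => ma; meas.
have f0 n x : (0 <= f n x)%E by rewrite lee_fin mulr_ge0 ?ppow_ge0.
have fE n : (\int[leb]_x f n x)%E =
    (Gamma (b n) * Gamma alpha / Gamma (b n + alpha))%:E.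
  by rewrite /f Beta_convolution// ppow_gt0E// powR1 mulr1.
have b0E : b 0%N - 1 = gamma by rewrite /b mul0r add0r addrK.
have H : ((\int[leb]_x f n x)%E @[n --> \oo] --> (\int[leb]_x (cst 0 x))%E).
  (* On []0, 1[] the integrands decrease in [n], so the one at [n = 0] dominates. It is integrable
     even for negative [gamma], as [gamma > - alpha > -1]. *)
  apply: (@dominated_cvg _ _ _ leb setT measurableT f _ (f 0%N)) => //.
  - move=> x _; rewrite /f.
    have [x1|x1] := leP 1 x.
      under eq_fun do rewrite (ppow_le0E (alpha - 1)) ?subr_le0// mulr0.
      exact: cvg_cst.
    have [x0|x0] := leP x 0.
      under eq_fun do rewrite (ppow_le0E _ x0) mul0r.
      exact: cvg_cst.
    apply/cvg_EFin; first by apply: nearW.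
    rewrite -[X in _ --> X](mul0r (ppow (alpha - 1) (1 - x))).
    apply: cvgM; last exact: cvg_cst.
    have -> : (fun n => ppow (b n - 1) x) = (fun n => x `^ gamma * (x `^ theta) ^+ n).
      apply/funext => n; rewrite ppow_gt0E// -powR_mulrn ?powR_ge0// -powRrM.
      rewrite -powRD ?(gt_eqF x0) ?implybT//; congr (_ `^ _); rewrite /b; ring.
    rewrite -[X in _ --> X](mulr0 (x `^ gamma)).
    apply: cvgM; first exact: cvg_cst.
    apply: cvg_expr; rewrite ger0_norm ?powR_ge0//.
    have -> : 1 = 1 `^ theta :> R by rewrite powR1.
    by apply: gt0_ltr_powR; rewrite ?nnegrE ?ltW.
  - apply/integrableP; split; [exact: mf|].
    have -> : (\int[leb]_x `|f 0%N x|)%E = (\int[leb]_x f 0%N x)%E.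
      by apply: eq_integral => x _; rewrite gee0_abs.
    by rewrite fE ltry.
  - move=> n x _; rewrite gee0_abs// lee_fin.
    have [x1|x1] := leP 1 x.
      by rewrite !(ppow_le0E (alpha - 1)) ?subr_le0// !mulr0.
    have [x0|x0] := leP x 0; first by rewrite !(ppow_le0E _ x0).
    rewrite ler_wpM2r ?ppow_ge0// !ppow_gt0E// ger_powR ?x0 ?(ltW x1)//.
    by rewrite b0E /b addrK lerDr mulr_ge0// ltW.
rewrite integral0 in H.
have HE : (fun n => \int[leb]_x f n x)%E =
    (fun n => (Gamma (b n) * Gamma alpha / Gamma (b n + alpha))%:E).
  by apply/funext => n; exact: fE.
by rewrite HE in H; move/fine_cvgP : H => [].
Qed.


(* The function [G] of the header: the multiplicative factor that turns the size-biased law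
   of [Z] back into the law of [Z]. *)
Definition beta_factor (v : R) : R := ppow 0 v * (ppow (- alpha) (1 - v `^ theta^-1) / Gamma (1 - alpha)).

Let G1a : 0 < Gamma (1 - alpha). Proof. by rewrite Gamma_gt0// subr_gt0. Qed.

Lemma measurable_beta_factor : measurable_fun setT beta_factor.
Proof.
have mp := @measurable_ppow R 0; have mpa := @measurable_ppow R (- alpha).
by rewrite /beta_factor; meas.
Qed.

Lemma beta_factor_ge0 v : 0 <= beta_factor v.
Proof. by rewrite mulr_ge0 ?ppow_ge0// divr_ge0 ?ppow_ge0// ltW. Qed.

Lemma beta_factor_le0 v : v <= 0 -> beta_factor v = 0.
Proof. by move=> v0; rewrite /beta_factor ppow_le0E// mul0r. Qed.

(** With [v = x ^ theta] and [s = (n + 1) theta], the Beta integral of [s] and [1 - alpha] makes the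
    left side [theta * Gamma s / Gamma (b n)]. On the right [Gamma (s + 1) = s * Gamma s] appears,
    and the [n + 1] in [s] cancels the explicit one. *)
Lemma beta_factor_moments n : (\int[leb]_v (beta_factor v * ppow n%:R v)%:E = (c n / (n.+1%:R * c n.+1))%:E)%E.
Proof.
pose f (v : R) : \bar R :=
  (ppow n%:R v * (ppow (- alpha) (1 - v `^ theta^-1) / Gamma (1 - alpha)))%:E.
have mpn := @measurable_ppow R n%:R; have mpa := @measurable_ppow R (- alpha).
have mf : measurable_fun setT f by rewrite /f; meas.
have f0 v : (0 <= f v)%E.
  by rewrite lee_fin mulr_ge0 ?ppow_ge0// divr_ge0 ?ppow_ge0// ltW.
transitivity (\int[leb]_v ((ppow 0 v)%:E * f v))%E.
  by apply: eq_integral => v _; rewrite /f -EFinM /beta_factor; congr EFin; ring.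
rewrite -(integral_ppow ltr01 (lt0r_neq0 theta0) mf f0).
pose s := n.+1%:R * theta; have s0 : 0 < s by rewrite mulr_gt0.
have a10 : 0 < 1 - alpha by rewrite subr_gt0.
transitivity (\int[leb]_x ((theta / Gamma (1 - alpha))%:E *
    (ppow (s - 1) x * ppow (1 - alpha - 1) (1 - x))%:E))%E.
  apply: eq_integral => x _; rewrite mul1r gtr0_norm// -!EFinM.
  have [x0|x0] := leP x 0; first by rewrite !(ppow_le0E _ x0) !(mulr0, mul0r).
  congr EFin; rewrite mul1r -powRrM mulfV ?gt_eqF// powRr1 ?ltW//.
  rewrite [ppow n%:R _]ppow_gt0E ?powR_gt0// !(ppow_gt0E _ x0).
  have -> : x `^ (s - 1) = x `^ (theta - 1) * x `^ theta `^ n%:R.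
    rewrite -powRrM -powRD ?(gt_eqF x0) ?implybT//; congr (_ `^ _).
    by rewrite /s -natr1; ring.
  by rewrite -/theta (_ : 1 - alpha - 1 = - alpha); [ring|ring].
have mps := @measurable_ppow R (s - 1); have mpa1 := @measurable_ppow R (1 - alpha - 1).
rewrite ge0_integralZl//; last 3 first.
- by meas.
- by move=> x _; rewrite lee_fin mulr_ge0 ?ppow_ge0.
- by rewrite lee_fin divr_ge0// ltW.
rewrite Beta_convolution// ppow_gt0E// powR1 mulr1 -EFinM; congr EFin.
have Gs1 := GammaD1 s0; have cS := c_coefS alpha gamma n.
have c0 := c_coef_gt0 alpha0 alpha1 theta0 n.
have Gb : 0 < Gamma (b n) by rewrite Gamma_gt0.
have Gs : 0 < Gamma s by rewrite Gamma_gt0.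
rewrite (_ : s + (1 - alpha) = b n); last by rewrite /s /b -natr1 /theta; ring.
rewrite (_ : alpha + (n%:R * (alpha + gamma) + gamma + 1) = s + 1) in cS; last first.
  by rewrite /s -natr1 /theta; ring.
rewrite /c cS Gs1 -/theta -/(b n).
have n0 : n.+1%:R != 0 :> R by rewrite pnatr_eq0.
have p0 := lt0r_neq0 Gs; have q0 := lt0r_neq0 Gb.
have r0 := lt0r_neq0 G1a; have u0 := lt0r_neq0 c0; have t0 := lt0r_neq0 theta0.
have sE : s = n.+1%:R * theta by [].
clearbody s; move: p0 q0 r0 u0 n0 t0 sE; rewrite -/theta.
move: (Gamma s) (Gamma (b n)) (Gamma (1 - alpha)) (c_coef alpha gamma n) (n.+1%:R : R) theta.
by move=> p q r u N t p0 q0 r0 u0 N0 t0 ->; field; rewrite p0 q0 r0 u0 N0 t0.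
Qed.


End Density.

Section ZDensity.
Context (R : realType) (d : measure_display) (T : measurableType d)
  (P : probability T R) (alpha gamma : R) (X : R -> T -> R).
Hypotheses (alpha0 : 0 < alpha) (alpha1 : alpha < 1) (theta0 : 0 < alpha + gamma).
Hypothesis SS : stable_subordinator P alpha X.
Let leb := @lebesgue_measure R.
Let c := c_coef alpha gamma.
(** The event where [Z] is infinite, null by [Zag_fin], is sent to 0, so quotients by [Zfin] are 0
    there. *)
Definition Zfin w : R := fine (Zag gamma X w).

Lemma Zfin_ge0 w : 0 <= Zfin w.
Proof. by rewrite fine_ge0// (Zag_ge0 gamma SS). Qed.

Lemma measurable_Zfin : measurable_fun setT Zfin.
Proof.
apply: (@measurableT_comp _ _ _ _ _ _ (@fine R) setT (Zag gamma X)) => //.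
exact: measurable_Zag SS.
Qed.

Lemma Zfin_moments n : (\int[P]_w (Zfin w ^+ n)%:E = (n`!%:R * c n)%:E)%E.
Proof.
have mZ := measurable_Zfin; have mZa := measurable_Zag gamma SS.
rewrite /c -(Zag_moments alpha0 alpha1 theta0 SS n).
apply: ge0_ae_eq_integral => //.
- by meas.
- rewrite (_ : (fun w => _) = (fun w => tail gamma X w 0 ^+ n)%E); last first.
    by apply/funext => w; rewrite (Zag_tail gamma SS).
  have mT : measurable_fun setT (fun w => tail gamma X w 0).
    by rewrite (_ : (fun w => _) = Zag gamma X)//; apply/funext => w; rewrite (Zag_tail gamma SS).
  elim: n => [|n ih]; first by under eq_fun do rewrite expe0; exact: measurable_cst.
  by under eq_fun do rewrite expeS; exact: emeasurable_funM.
- by move=> w _; rewrite lee_fin exprn_ge0 ?Zfin_ge0.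
- by move=> w _; apply: expe_ge0; exact: Zag_ge0 SS w.
have := Zag_fin alpha0 alpha1 theta0 SS.
apply: filterS => w Zw _; rewrite /Zfin.
by rewrite EFin_expe fineK.
Qed.

Section Factor.
Variable factor : R -> R.
Hypotheses (mfac : measurable_fun setT factor) (fac_ge0 : forall v, 0 <= factor v).
Hypothesis fac_le0 : forall v, v <= 0 -> factor v = 0.
Hypothesis fac_moments : forall n,
  (\int[leb]_v (factor v * ppow n%:R v)%:E = (c n / (n.+1%:R * c n.+1))%:E)%E.

Local Opaque Zfin.

(** Candidate density, kept in the extended reals since it may be infinite on a null set. Where
    [Zfin] is 0 the quotient is 0, and there [factor] vanishes. *)
Let K (z : R) : \bar R := \int[P]_w (factor (z / Zfin w))%:E.

Let mfz : measurable_fun setT (fun x : measurableTypeR R * T => factor (x.1 / Zfin x.2)).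
Proof.
have mZ := measurable_Zfin; apply: (measurableT_comp mfac).
apply: measurable_funM; first by meas.
by apply: (measurableT_comp measurable_inv); meas.
Qed.

Let mK : measurable_fun setT K.
Proof.
have mF : measurable_fun setT (fun x : measurableTypeR R * T => (factor (x.1 / Zfin x.2))%:E).
  exact/measurable_EFinP.
apply: (@measurable_fun_fubini_tonelli_F _ _ _ _ R P _ mF) => x.
by rewrite lee_fin fac_ge0.
Qed.

Let K_ge0 z : (0 <= K z)%E.
Proof. by apply: integral_ge0 => w _; rewrite lee_fin fac_ge0. Qed.

(** The law of [Zfin] has the same moments as the image, under the product of [Zfin] and the
    variable of [factor], of the measure with weight [Zfin * factor]; so the two coincide. In the
    substitution [z = Z v] the Jacobian then cancels the weight [Zfin]. *)
Let KI (g : R -> \bar R) : measurable_fun setT g -> (forall x, 0 <= g x)%E ->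
  (\int[P]_w g (Zfin w) = \int[leb]_z (K z * g z))%E.
Proof.
move=> mg g0; have mZ := measurable_Zfin.
pose W1 (w : T) : R := 1.
pose W2 (x : T * measurableTypeR R) : R := Zfin x.1 * factor x.2.
pose V2 (x : T * measurableTypeR R) : R := Zfin x.1 * Num.max 0 x.2.
have mW2 : measurable_fun setT W2 by rewrite /W2; meas.
have mmax : measurable_fun setT (fun x : R => Num.max 0 x) by exact: measurable_maxr.
have mV2 : measurable_fun setT V2.
  apply: measurable_funM; first by meas.
  by apply: (measurableT_comp mmax); exact: measurable_snd.
have W20 x : 0 <= W2 x by rewrite mulr_ge0 ?Zfin_ge0.
have V20 x : 0 <= V2 x by rewrite mulr_ge0 ?Zfin_ge0// le_max lexx.
have fmax n v : factor v * Num.max 0 v ^+ n = factor v * ppow n%:R v.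
  have [v0|v0] := leP v 0; first by rewrite fac_le0// !mul0r.
  by rewrite ppow_gt0E// powR_mulrn ?ltW.
(* The moment of the factor multiplies [E Z ^ (n + 1) = (n + 1)! c_(n + 1)] and cancels all but
   [n! c_n]. *)
have M2 n : (\int[P \x leb]_x (W2 x * V2 x ^+ n)%:E = (n`!%:R * c n)%:E)%E.
  pose F x := (W2 x * V2 x ^+ n)%:E.
  have mF : measurable_fun setT F by rewrite /F; meas.
  have F0 x : (0 <= F x)%E by rewrite lee_fin mulr_ge0 ?exprn_ge0.
  rewrite (@fubini_tonelli1 _ _ _ _ R P (@lebesgue_measure R) F mF F0).
  transitivity (\int[P]_w ((Zfin w ^+ n.+1)%:E * (c n / (n.+1%:R * c n.+1))%:E))%E.
    apply: eq_integral => w _; rewrite -fac_moments /fubini_F.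
    have mpn := @measurable_ppow R n%:R.
    rewrite -ge0_integralZl//; last 3 first.
    - by meas.
    - by move=> v _; rewrite lee_fin mulr_ge0 ?ppow_ge0.
    - by rewrite lee_fin exprn_ge0 ?Zfin_ge0.
    apply: eq_integral => v _; rewrite /F /W2 /V2 /= -EFinM -fmax; congr EFin.
    by rewrite exprMn exprS; ring.
  have cn n' := c_coef_gt0 alpha0 alpha1 theta0 n'.
  rewrite ge0_integralZr//; last 3 first.
  - by meas.
  - by move=> w _; rewrite lee_fin exprn_ge0 ?Zfin_ge0.
  - by rewrite lee_fin divr_ge0 ?mulr_ge0// ltW ?cn.
  rewrite Zfin_moments -EFinM; congr EFin; rewrite factS natrM.
  have n0 : n.+1%:R != 0 :> R by rewrite pnatr_eq0.
  have : c n.+1 != 0 by rewrite gt_eqF ?cn.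
  move: (c n.+1) (c n) (n`!%:R : R) (n.+1%:R : R) n0 => p q r u u0 p0.
  by field; rewrite u0 p0.
have M1 n : (\int[P]_w (W1 w * Zfin w ^+ n)%:E = (n`!%:R * c n)%:E)%E.
  by rewrite -Zfin_moments; apply: eq_integral => w _; rewrite mul1r.
have cb (x : R) : 0 <= x -> cvgn (series (fun n => c n * x ^+ n)).
  by move=> _; exact: (fast_decay_cvg (c_coef_fast_decay alpha0 alpha1 theta0)).
have mW1 : measurable_fun setT W1 by exact: measurable_cst.
have W10 x : 0 <= W1 x by exact: ler01.
have E := moments_unique mW1 mZ mW2 mV2 W10 Zfin_ge0 W20 V20 M1 M2 cb mg g0.
transitivity (\int[P]_w ((W1 w)%:E * g (Zfin w)))%E.
  by apply: eq_integral => w _; rewrite mul1e.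
rewrite E.
pose F x := ((W2 x)%:E * g (V2 x))%E.
have mF : measurable_fun setT F by rewrite /F; meas.
have F0 x : (0 <= F x)%E by rewrite mule_ge0 ?lee_fin.
rewrite (@fubini_tonelli1 _ _ _ _ R P (@lebesgue_measure R) F mF F0).
pose H (x : T * measurableTypeR R) := ((factor (x.2 / Zfin x.1))%:E * g x.2)%E.
have mH : measurable_fun setT H.
  apply: emeasurable_funM; last by apply: (measurableT_comp mg); meas.
  apply/measurable_EFinP; apply: (measurableT_comp mfac).
  apply: measurable_funM; first by meas.
  by apply: (measurableT_comp measurable_inv); meas.
have H0 x : (0 <= H x)%E by rewrite mule_ge0 ?lee_fin.
transitivity (\int[P]_w \int[leb]_z H (w, z))%E.
  apply: eq_integral => w _; rewrite /fubini_F.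
  (* Where [Zfin] is 0 no substitution is possible, but both integrands vanish: one by its weight,
     the other because [factor] is 0 at 0. *)
  have := Zfin_ge0 w; rewrite le_eqVlt => /orP[/eqP Z0|Z0].
    rewrite !integral0_eq// => v _; rewrite /H /F /W2 /= -Z0.
      by rewrite invr0 mulr0 fac_le0// mul0e.
    by rewrite mul0r mul0e.
  apply: etrans (@integral_affine _ (Zfin w) 0 (fun z => H (w, z)) (lt0r_neq0 Z0)
    (measurable_fun_pair2 w mH) (fun=> H0 _)).
  apply: eq_integral => v _; rewrite /F /H /W2 /V2 /= addr0 (gtr0_norm Z0).
  rewrite mulrAC divff ?gt_eqF// mul1r EFinM muleA.
  have [v0|v0] := leP v 0; first by rewrite fac_le0// !(mule0, mul0e).
  by [].
rewrite (@fubini_tonelli _ _ _ _ R P (@lebesgue_measure R) H mH H0).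
apply: eq_integral => z _; rewrite /H /=.
rewrite ge0_integralZr//.
- by apply/measurable_EFinP; exact: (measurable_fun_pair2 z mfz).
- by move=> w _; rewrite lee_fin.
Qed.

(** [K] integrates to the total mass 1 of [P], so it is finite almost everywhere and [fine] alters
    it only on a null set. *)
Lemma Zfin_density_of_factor : exists k : R -> R, [/\ measurable_fun setT k,
  forall z, 0 <= k z, forall z, z <= 0 -> k z = 0 &
  forall g : R -> \bar R, measurable_fun setT g -> (forall x, 0 <= g x)%E ->
  (\int[P]_w g (Zfin w) = \int[leb]_z ((k z)%:E * g z))%E].
Proof.
exists (fine \o K); split.
- by apply: measurableT_comp => //; exact: mK.
- by move=> z; rewrite fine_ge0.
- move=> z z0; rewrite /= /K integral0_eq// => w _.
  by rewrite fac_le0// mulr_le0_ge0// invr_ge0 Zfin_ge0.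
move=> g mg g0; rewrite KI//.
have fin : {ae (@lebesgue_measure R), forall z, K z \is a fin_num}.
  apply: (@filterS _ _ (ae_filter_ringOfSetsType (@lebesgue_measure R)) (fun z => setT z -> K z \is a fin_num)) => [z|]; first exact.
  apply: integrable_ae => //; apply/integrableP; split; first exact: mK.
  have -> : (\int[leb]_z `|K z| = \int[leb]_z (K z * cst 1 z))%E.
    by apply: eq_integral => z _; rewrite gee0_abs// mule1.
  rewrite -KI//; have PT : P setT = 1%E by exact: probability_setT.
  by rewrite integral_cst// mul1e [X in (X < _)%E]PT ltry.
apply: ge0_ae_eq_integral => //.
- by apply: emeasurable_funM => //; exact: mK.
- apply: emeasurable_funM => //; apply/measurable_EFinP.
  by apply: measurableT_comp => //; exact: mK.
- by move=> z _; rewrite mule_ge0.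
- by move=> z _; rewrite mule_ge0// lee_fin fine_ge0.
by apply: (@filterS _ _ (ae_filter_ringOfSetsType (@lebesgue_measure R)) _ _ _ fin) => z Kz _ /=;
  rewrite fineK.
Qed.

End Factor.

Lemma Zfin_density : exists k : R -> R, [/\ measurable_fun setT k,
  forall z, 0 <= k z, forall z, z <= 0 -> k z = 0 &
  forall g : R -> \bar R, measurable_fun setT g -> (forall x, 0 <= g x)%E ->
  (\int[P]_w g (Zfin w) = \int[leb]_z ((k z)%:E * g z))%E].
Proof.
apply: (@Zfin_density_of_factor (beta_factor alpha gamma)).
- exact: measurable_beta_factor.
- exact: beta_factor_ge0.
- exact: beta_factor_le0.
- exact: beta_factor_moments.
Qed.

End ZDensity.

(** * The inverse process *)

Section Inverse.
Context (R : realType) (d : measure_display) (T : measurableType d)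
  (P : probability T R) (alpha gamma : R) (X : R -> T -> R).
Hypotheses (alpha0 : 0 < alpha) (alpha1 : alpha < 1) (theta0 : 0 < alpha + gamma).
Hypothesis SS : stable_subordinator P alpha X.
Let leb := @lebesgue_measure R.
Let theta := alpha + gamma.
Let c := c_coef alpha gamma.

Lemma ereal_inf_gt (a : R) : ereal_inf (EFin @` [set x : R | a < x]) = a%:E.
Proof.
apply/eqP; rewrite eq_le; apply/andP; split.
- apply/lee_addgt0Pr => e e0; apply: ereal_inf_lbound.
  by exists (a + e) => //=; rewrite ltrDl.
- by apply: le_ereal_inf_tmp => _ [x /= ax <-]; rewrite lee_fin ltW.
Qed.

(* When [Z = +oo] both sides are 0, since [fine +oo = 0] and [t / 0 = 0]. *)
Lemma AagE t w : 0 <= t ->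
  Aag alpha gamma X t w = ((t / Zfin gamma X w) `^ theta^-1)%:E.
Proof.
move=> t0; rewrite -ereal_inf_gt /Aag; congr (ereal_inf (EFin @` _)).
have thV0 : 0 < theta^-1 by rewrite invr_gt0.
rewrite /Zfin; have := Zag_gt0 gamma SS w; case: (Zag gamma X w) => [z| |]//=.
- rewrite lte_fin => z0.
  have tz0 : 0 <= t / z by rewrite divr_ge0// ltW.
  apply/seteqP; split=> x /=.
    move=> [x0]; rewrite -EFinM lte_fin -ltr_pdivrMr// => H.
    have -> : x = (x `^ theta) `^ theta^-1 by rewrite -powRrM divff ?gt_eqF// powRr1.
    by apply: gt0_ltr_powR; rewrite ?nnegrE ?powR_ge0.
  move=> H; have x0 : 0 <= x by rewrite (le_trans (powR_ge0 _ _) (ltW H)).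
  split=> //; rewrite -EFinM lte_fin -ltr_pdivrMr//.
  have -> : t / z = ((t / z) `^ theta^-1) `^ theta.
    by rewrite -powRrM mulVf ?gt_eqF// powRr1.
  by apply: gt0_ltr_powR; rewrite ?nnegrE ?powR_ge0.
- move=> _; rewrite invr0 mulr0 powR0 ?gt_eqF//.
  apply/seteqP; split=> x /=.
    move=> [x0 H]; rewrite lt_neqAle x0 andbT; apply/eqP => xz.
    by move: H; rewrite -xz powR0 ?gt_eqF// mul0e lte_fin ltNge t0.
  by move=> x0; split; [exact: ltW|rewrite gt0_muley ?ltry// lte_fin powR_gt0].
Qed.

Variable k : R -> R.
Hypotheses (mk : measurable_fun setT k) (k0 : forall z, 0 <= k z).
Hypothesis k_le0 : forall z, z <= 0 -> k z = 0.
Hypothesis kE : forall g : R -> \bar R, measurable_fun setT g -> (forall x, 0 <= g x)%E ->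
  (\int[P]_w g (Zfin gamma X w) = \int[leb]_z ((k z)%:E * g z))%E.

Definition inverse_density (x t : R) : R :=
  ppow (- theta - 1) x * (theta * t * k (t * x `^ (- theta))).

Lemma measurable_inverse_density t :
  measurable_fun setT (fun x => inverse_density x t).
Proof.
have mp := @measurable_ppow R (- theta - 1).
by rewrite /inverse_density; meas.
Qed.

Lemma inverse_density_ge0 x t : 0 <= t -> 0 <= inverse_density x t.
Proof. by move=> t0; rewrite !mulr_ge0 ?ppow_ge0// ltW. Qed.

Lemma inverse_densityP t (B : set R) : 0 < t -> measurable B ->
  P (Aag alpha gamma X t @^-1` (EFin @` B)) =
  (\int[leb]_(x in B) (inverse_density x t)%:E)%E.
Proof.
move=> t0 mB; have mZ := measurable_Zfin gamma SS.
pose f (z : R) : R := (t / z) `^ theta^-1.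
have mf : measurable_fun setT f.
  apply: (measurableT_comp (measurable_powR _)); apply: measurable_funM => //.
  exact: measurable_inv.
have mB1 : measurable_fun setT (\1_B : R -> R) by exact: measurable_indic.
have -> : Aag alpha gamma X t @^-1` (EFin @` B) = (fun w => f (Zfin gamma X w)) @^-1` B.
  apply/seteqP; split=> w /=; rewrite AagE ?(ltW t0)//.
    by move=> [x Bx [xE]]; rewrite /f -xE.
  by move=> Bw; exists (f (Zfin gamma X w)).
pose g z : \bar R := (\1_B (f z))%:E.
have mg : measurable_fun setT g by apply/measurable_EFinP; exact: measurableT_comp.
have g0 z : (0 <= g z)%E by rewrite lee_fin.
have mS : measurable ((fun w => f (Zfin gamma X w)) @^-1` B).
  rewrite -[X in measurable X]setTI.
  by have mfZ := measurableT_comp mf mZ; apply: mfZ.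
transitivity (\int[P]_w g (Zfin gamma X w))%E.
  rewrite -[RHS]/(\int[P]_w (\1_((fun w => f (Zfin gamma X w)) @^-1` B) w)%:E)%E.
  by rewrite integral_indic// setIT.
rewrite kE//.
pose F z : \bar R := ((k z)%:E * g z)%E.
have mF : measurable_fun setT F by apply: emeasurable_funM => //; exact/measurable_EFinP.
have F0 z : (0 <= F z)%E by rewrite mule_ge0 ?lee_fin.
transitivity (\int[leb]_z ((ppow 0 z)%:E * F z))%E.
  apply: eq_integral => z _; have [z0|z0] := leP z 0.
    by rewrite k_le0// ppow_le0E// !mul0e.
  by rewrite ppow_gt0E// powRr0 mul1e.
have th0 : - theta != 0 by rewrite oppr_eq0 gt_eqF.
(* The substitution [z = t * x ^ (- theta)] has Jacobian [theta * t * x ^ (- theta - 1)], the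
   prefactor of the density, and satisfies [f z = x]. *)
rewrite -(integral_ppow t0 th0 mF F0) [RHS]integral_mkcond.
apply: eq_integral => x _; rewrite /F /g -!EFinM patchE.
have -> : (if x \in B then (inverse_density x t)%:E else 0%E) =
    (inverse_density x t * \1_B x)%:E.
  by rewrite indicE; case: ifP => _; rewrite ?mulr1 ?mulr0.
congr EFin; rewrite /inverse_density normrN (gtr0_norm theta0).
have [x0|x0] := leP x 0; first by rewrite !(ppow_le0E _ x0) !(mulr0, mul0r).
have -> : f (t * x `^ (- theta)) = x.
  rewrite /f invfM mulrA divff ?gt_eqF// mul1r -powRN opprK -powRrM.
  by rewrite divff ?gt_eqF// powRr1// ltW.
by rewrite -/theta; ring.
Qed.

Lemma inverse_density_laplace x eta : 0 < x -> 0 < eta ->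
  (\int[leb]_(t in `]0%R, +oo[) (expR (- eta * t) * inverse_density x t)%:E =
   (theta * x `^ (theta - 1) *
     limn (pseries (pseries_diffs c) (- (eta * x `^ theta))))%:E)%E.
Proof.
move=> x0 eta0.
have mZ := measurable_Zfin gamma SS.
have Z0 := Zfin_ge0 gamma SS.
set y := x `^ theta; have y0 : 0 < y by rewrite powR_gt0.
pose F (t : R) : \bar R := (ppow 0 t * (expR (- eta * t) * inverse_density x t))%:E.
have mp0 := @measurable_ppow R 0.
have mF : measurable_fun setT F.
  by rewrite /F /inverse_density; meas.
have F0 t : (0 <= F t)%E.
  rewrite lee_fin; have [t0|t0] := leP t 0; first by rewrite ppow_le0E// mul0r.
  by rewrite mulr_ge0 ?ppow_ge0// mulr_ge0 ?expR_ge0// inverse_density_ge0// ltW.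
transitivity (\int[leb]_t F t)%E.
  transitivity (\int[leb]_(t in `]0%R, +oo[)
      ((t `^ 0)%:E * (expR (- eta * t) * inverse_density x t)%:E))%E.
    by apply: eq_integral => t _; rewrite powRr0 mul1e.
  by rewrite ppow_restrict; apply: eq_integral => t _; rewrite -EFinM.
(* At fixed [x] the substitution [t = y * z] is linear and turns the argument of [k] into [z]. *)
rewrite -(@integral_affine _ y 0 F) ?gt_eqF//.
pose g z : \bar R := (ppow 1 z * expR (- (eta * y) * z))%:E.
have mp1 := @measurable_ppow R 1.
have mg : measurable_fun setT g by rewrite /g; meas.
have g0 z : (0 <= g z)%E by rewrite lee_fin mulr_ge0 ?ppow_ge0 ?expR_ge0.
transitivity (\int[leb]_z ((theta * x `^ (theta - 1))%:E * ((k z)%:E * g z)))%E.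
  apply: eq_integral => z _; rewrite addr0 /F /g -!EFinM (gtr0_norm y0); congr EFin.
  have [z0|z0] := leP z 0.
    by rewrite k_le0// !ppow_le0E ?pmulr_rle0// !(mul0r, mulr0).
  rewrite /inverse_density ppow_gt0E ?mulr_gt0// powRr0 mul1r.
  rewrite !ppow_gt0E// powRr1 ?(ltW z0)//.
  have -> : y * z * x `^ (- theta) = z by rewrite powRN -/y mulrAC mulfV ?gt_eqF// mul1r.
  (* One factor [y] is the Jacobian, the other comes from the factor [t = y * z] of the density,
     whose [z] goes into [g]. *)
  have -> : x `^ (theta - 1) = y * y * x `^ (- theta - 1).
    rewrite /y -!powRD ?(gt_eqF x0) ?implybT//; congr (_ `^ _); ring.
  have -> : - eta * (y * z) = - (eta * y) * z by ring.
  by ring.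
rewrite ge0_integralZl//; last 3 first.
- by apply: emeasurable_funM => //; exact/measurable_EFinP.
- by move=> z _; apply: mule_ge0; [rewrite lee_fin|exact: g0].
- by rewrite lee_fin mulr_ge0 ?powR_ge0// ltW.
rewrite -kE// [RHS]EFinM; congr (_ * _)%E.
(* Weighting by [Z] shifts the moments: [(n + 1)! c_(n + 1)] is [n!] times the coefficient of the
   differentiated series, so [laplace_of_moments] applies with [Z] as both weight and variable. *)
have M n : (\int[P]_w (Zfin gamma X w * Zfin gamma X w ^+ n)%:E =
    (n`!%:R * pseries_diffs c n)%:E)%E.
  transitivity (\int[P]_w (Zfin gamma X w ^+ n.+1)%:E)%E.
    by apply: eq_integral => w _; rewrite exprS.
  rewrite (Zfin_moments alpha0 alpha1 theta0 SS) /pseries_diffs factS natrM.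
  by congr EFin; rewrite /c; ring.
have cb (r : R) : 0 <= r -> cvgn (series (fun n => pseries_diffs c n * r ^+ n)).
  move=> _; exact: (fast_decay_cvg (fast_decay_diffs (c_coef_fast_decay alpha0 alpha1 theta0))).
have ey0 : 0 <= eta * y by rewrite ltW// mulr_gt0.
rewrite -(laplace_of_moments mZ mZ Z0 Z0 M cb ey0).
apply: eq_integral => w _; rewrite /g; congr EFin; rewrite mulNr.
have := Z0 w; rewrite le_eqVlt => /orP[/eqP <-|Zw]; first by rewrite ppow_le0E// !mul0r.
by rewrite ppow_gt0E// powRr1// ltW.
Qed.

End Inverse.

Lemma c_coefE {R : realType} (alpha gamma : R) n :
  c_coef alpha gamma n = (gbr_fact (alpha + gamma) alpha n)^-1.
Proof.
rewrite /gbr_fact big_add1/= -prodfV /c_coef; apply: eq_bigr => j _.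
rewrite /gbr invf_div.
have -> : (alpha + gamma) * j.+1%:R - alpha + 1 = j%:R * (alpha + gamma) + gamma + 1.
  by rewrite -natr1; ring.
by rewrite (mulrC (alpha + gamma)).
Qed.

Lemma KS_coefE {R : realType} (alpha gamma : R) n : alpha != 0 ->
  KS_coef alpha (1 + gamma / alpha) (gamma / alpha) n = c_coef alpha gamma n.
Proof.
move=> a0; rewrite /KS_coef big_add1/= /c_coef; apply: eq_bigr => j _.
have -> : 1 + alpha * (j%:R * (1 + gamma / alpha) + gamma / alpha) =
    j%:R * (alpha + gamma) + gamma + 1 by field.
have -> // : 1 + alpha * (j%:R * (1 + gamma / alpha) + gamma / alpha + 1) =
    j.+1%:R * (alpha + gamma) + 1.
by rewrite -natr1; field.
Qed.

Section MainTheorem.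
Context {R : realType} (alpha gamma : R).
Hypotheses (alpha0 : 0 < alpha) (alpha1 : alpha < 1) (theta0 : 0 < alpha + gamma).
Let theta := alpha + gamma.
Let c := c_coef alpha gamma.

Lemma diffs_seriesE (x eta : R) : 0 <= x ->
  series (fun l : nat => l.+1%:R * (- eta) ^+ l
                  * powR x (l%:R * (alpha + gamma)) * c_coef alpha gamma l.+1) =
  pseries (pseries_diffs c) (- (eta * x `^ theta)).
Proof.
move=> x0; congr series; apply/funext => l; rewrite /pseries_diffs /c.
have -> : x `^ (l%:R * (alpha + gamma)) = (x `^ theta) ^+ l.
  by rewrite mulrC powRrM powR_mulrn ?powR_ge0.
have -> : - (eta * x `^ theta) = - eta * x `^ theta by rewrite mulNr.
by rewrite /= exprMn; ring.
Qed.

Lemma KilbasSaigo_derive (x eta : R) : 0 < x ->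
  is_derive x 1 (fun y : R => KilbasSaigo alpha (1 + gamma / alpha) (gamma / alpha)
                   (- eta * powR y (alpha + gamma)))
    (- eta * (theta * x `^ (theta - 1)) *
      limn (pseries (pseries_diffs c) (- (eta * x `^ theta)))).
Proof.
move=> x0.
have KE z : KilbasSaigo alpha (1 + gamma / alpha) (gamma / alpha) z = limn (pseries c z).
  rewrite /KilbasSaigo /pseries; congr (limn (series _)); apply/funext => n.
  by rewrite KS_coefE ?gt_eqF.
have -> : (fun y : R => KilbasSaigo alpha (1 + gamma / alpha) (gamma / alpha)
    (- eta * powR y (alpha + gamma))) =
    (fun z => limn (pseries c z)) \o (fun y => - eta * y `^ theta).
  by apply/funext => y; rewrite KE.
have d1 := is_derive1_powR theta x0.
have d2 : is_derive x 1 (fun y : R => - eta * y `^ theta) (- eta * (theta * x `^ (theta - 1))).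
  exact: (@is_deriveZ _ _ _ _ (- eta) _ _ _ d1).
have cd : fast_decay c by exact: c_coef_fast_decay.
have d3 := fast_decay_derive (- eta * x `^ theta) cd.
have -> : - (eta * x `^ theta) = - eta * x `^ theta by rewrite mulNr.
rewrite [X in is_derive _ _ _ X]mulrC.
exact (@is_derive1_comp R (fun z => limn (pseries c z)) (fun y => - eta * y `^ theta)
  x _ _ d3 d2).
Qed.

End MainTheorem.

Unset Implicit Arguments.
Theorem mainTheorem2 (R : realType) (d : measure_display) (T : measurableType d)
    (P : probability T R) (alpha gamma : R) (X : R -> T -> R) :
  0 < alpha -> alpha < 1 -> 0 < alpha + gamma ->
  stable_subordinator P alpha X ->
  [/\ {ae P, forall w, Aag alpha gamma X 0 w = 0%E},
      {ae P, forall w, forall s t, 0 <= s -> s <= t ->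
          (Aag alpha gamma X s w <= Aag alpha gamma X t w)%E},
      (forall x eta : R, 0 <= x ->
          cvgn (series (fun l : nat => l.+1%:R * (- eta) ^+ l
                  * powR x (l%:R * (alpha + gamma)) * c_coef alpha gamma l.+1))),
      (forall n : nat, (1 <= n)%N ->
          c_coef alpha gamma n = (gbr_fact (alpha + gamma) alpha n)^-1) &
      exists h : R -> R -> R,
        (forall t, 0 < t ->
           measurable_fun setT (fun x => h x t) /\ (forall x, 0 <= h x t) /\
           forall B : set R, measurable B ->
             P (Aag alpha gamma X t @^-1` (EFin @` B)) =
             (\int[lebesgue_measure]_(x in B) (h x t)%:E)%E) /\
        (forall x eta : R, 0 < x -> 0 < eta ->
           let E := fun y : R => KilbasSaigo alpha (1 + gamma / alpha) (gamma / alpha)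
                                   (- eta * powR y (alpha + gamma)) in
           derivable E x 1 /\
           (\int[lebesgue_measure]_(t in `]0%R, +oo[%classic)
               (expR (- eta * t) * h x t)%:E)%E = (- eta^-1 * derive1 E x)%:E /\
           - eta^-1 * derive1 E x =
             (alpha + gamma) * powR x (alpha + gamma - 1) *
             limn (series (fun l : nat => l.+1%:R * (- eta) ^+ l
                  * powR x (l%:R * (alpha + gamma)) * c_coef alpha gamma l.+1)))].
Proof.
move=> alpha0 alpha1 theta0 SS; split.
(* Both path properties hold for every [w]: at [t = 0] the explicit formula is a power of 0 whatever
   [Z] is, and raising the level shrinks the set whose infimum is taken. *)
- apply: aeW => w; rewrite (AagE theta0 SS)// mul0r powR0// invr_eq0 gt_eqF//.
- apply: aeW => w s t s0 st; apply: le_ereal_inf_tmp => _ [x [x0 tx] <-].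
  apply: ereal_inf_lbound; exists x => //; split => //.
  by rewrite (le_lt_trans _ tx)// lee_fin.
- move=> x eta x0; rewrite diffs_seriesE//.
  by apply: fast_decay_cvg; apply: fast_decay_diffs; exact: c_coef_fast_decay.
- by move=> n _; exact: c_coefE.
have [k [mk k0 k_le0 kE]] := Zfin_density alpha0 alpha1 theta0 SS.
exists (inverse_density alpha gamma k); split.
  move=> t t0; split; first exact: measurable_inverse_density.
  split; first by move=> x; apply: inverse_density_ge0 => //; exact: ltW.
  move=> B mB; exact: (inverse_densityP theta0 SS mk k0 k_le0 kE t0 mB).
move=> x eta x0 eta0 E.
have [dE E'] := KilbasSaigo_derive alpha0 alpha1 theta0 eta x0.
split; first exact: dE.
have E'E : - eta^-1 * derive1 E x = (alpha + gamma) * powR x (alpha + gamma - 1) *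
    limn (pseries (pseries_diffs (c_coef alpha gamma)) (- (eta * x `^ (alpha + gamma)))).
  rewrite derive1E E' mulrA mulrA mulNr mulrN mulrA mulVf ?gt_eqF//; ring.
rewrite E'E (diffs_seriesE _ _ _ (ltW x0)); split => //.
exact: (inverse_density_laplace alpha0 alpha1 theta0 SS mk k0 k_le0 kE x0 eta0).
Qed.
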